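(* Let $k$ be a nonnegative integer. Every finite simple graph $G$ having at most $k$ vertices of degree less than three and having at least $5k^2$ vertices contains two cycles whose lengths differ by one or two.
   Context: Graphs are finite and simple. The degree of a vertex is the number of edges incident to it. A cycle is a subgraph forming a closed path with at least three distinct vertices; its length is its number of edges. The two cycles are distinct cycles of $G$ with $|\,|C_1|-|C_2|\,|\in\{1,2\}$. *)

(* Defs.v *)
From mathcomp Require Import all_boot.
Set Implicit Arguments.
Unset Strict Implicit.
Unset Printing Implicit Defensive.

(* A finite simple graph is a symmetric irreflexive relation e on a finType,  *)
(* so the edges at v correspond bijectively to the neighbours of v.           *)
Definition simple_graph (T : finType) (e : rel T) : Prop :=
  symmetric e /\ irreflexive e.

Definition degree (T : finType) (e : rel T) (v : T) : nat :=
  #|[set w | e v w]|.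

(* A cycle is given by its vertices listed in cyclic order; its number of     *)
(* edges is then size c. The bound on the size matters: ucycle also accepts   *)
(* the empty sequence and the two ends of an edge.                            *)
Definition is_cycle (T : finType) (e : rel T) (c : seq T) : bool :=
  ucycleb e c && (3 <= size c).

(* Main.v *)
(** Suppose no two cycles have lengths differing by one or two. If C is a cycle and Q a connected
    set disjoint from C, then two vertices of C at distance (|C|-1)/2 on C cannot both have
    neighbours in Q; hence Q is attached to at most half of C, and to exactly half of C only if
    the attachments alternate.

    Let F be a maximal connected set whose complement R contains a cycle, and let Y be the set of
    vertices of R adjacent to F. Every y in Y meets all cycles of R. If Y has at least two
    elements, counting edges of the forest R - y gives |R \ Y| <= 2s and, with the half bound,
    |Y| <= s, where s is the number of vertices of R of degree less than three. Starting with F a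
    geodesic through the small vertices (those of degree less than three), this yields the theorem
    of Bondy and Vince: if at most two vertices are small, then all vertices are small.

    In general, delete R \ Y. The number k of small vertices does not grow. If it drops, or if
    |Y| <= 1 (a cut vertex), use induction. Otherwise Y alternates on a cycle of R, all of Y
    becomes small, and consecutive elements of Y stay joined by a deleted path of length two; such
    a path is incompatible with its ends lying in the set R of a later deletion, so fewer than k
    deletions of this kind take place, and they delete at most 2k vertices altogether. *)
Require Import Defs.
From mathcomp Require Import all_boot all_order all_algebra.
From mathcomp Require Import zify.
From Stdlib Require Import Classical.
Set Implicit Arguments.
Unset Strict Implicit.
Unset Printing Implicit Defensive.

Section Cycles.

Ltac goal_lia := clear; lia.

Variables (T : finType) (e : rel T).
Hypotheses (e_sym : symmetric e) (e_irr : irreflexive e).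
Implicit Types (A B F Q R W X Y Z : {set T}) (c p s t : seq T) (u v w x y z : T).

Definition dg A v := #|[set w in A | e v w]|.

Definition small A := [set v in A | dg A v < 3].

Definition has_cycle A := exists2 c, is_cycle e c & {subset c <= A}.

Definition conn A :=
  {in A &, forall u v, connect [rel x y | [&& x \in A, y \in A & e x y]] u v}.

Definition touches A v := [exists q in A, e v q].

Definition spread_out :=
  forall c1 c2, is_cycle e c1 -> is_cycle e c2 ->
  size c1 < size c2 -> (size c1).+2 < size c2.

Lemma touchesP A v : reflect (exists2 q, q \in A & e v q) (touches A v).
Proof. exact: (iffP exists_inP). Qed.

Lemma cycle_glue x s y t :
  cycle e (x :: s ++ y :: t) = path e x (rcons s y) && path e y (rcons t x).
Proof.
by rewrite /= rcons_cat cat_path !rcons_path /= !andbA.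
Qed.

Lemma rev_path_sym x s y :
  path e x (rcons s y) = path e y (rcons (rev s) x).
Proof.
have := rev_path e x (rcons s y).
rewrite last_rcons belast_rcons rev_cons => ->.
by apply: eq_path => a b; rewrite /= e_sym.
Qed.

Lemma rot_is_cycle n c : is_cycle e (rot n c) = is_cycle e c.
Proof. by rewrite /is_cycle /ucycleb rot_cycle rot_uniq size_rot. Qed.

Lemma conn1 x : conn [set x].
Proof. by move=> u v; rewrite !inE => /eqP -> /eqP ->; exact: connect0. Qed.

Lemma sub_conn A B u v : A \subset B ->
  connect [rel x y | [&& x \in A, y \in A & e x y]] u v ->
  connect [rel x y | [&& x \in B, y \in B & e x y]] u v.
Proof.
move=> sAB; apply: connect_sub => x y /= /and3P [xA yA exy].
by apply: connect1; rewrite /= !(subsetP sAB).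
Qed.

Lemma connU A B a b : conn A -> conn B -> a \in A -> b \in B -> e a b ->
  conn (A :|: B).
Proof.
move=> cA cB aA bB eab.
have sA := subsetUl A B; have sB := subsetUr A B.
have ab : connect [rel x y | [&& x \in A :|: B, y \in A :|: B & e x y]] a b.
  by apply: connect1; rewrite /= !inE aA bB eab orbT.
have ba : connect [rel x y | [&& x \in A :|: B, y \in A :|: B & e x y]] b a.
  by apply: connect1; rewrite /= !inE aA bB e_sym eab orbT.
move=> u v; rewrite !inE => /orP [uA|uB] /orP [vA|vB].
- exact: sub_conn (cA _ _ uA vA).
- apply: connect_trans (sub_conn sA (cA _ _ uA aA)) _.
  exact: connect_trans ab (sub_conn sB (cB _ _ bB vB)).
- apply: connect_trans (sub_conn sB (cB _ _ uB bB)) _.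
  exact: connect_trans ba (sub_conn sA (cA _ _ aA vA)).
- exact: sub_conn (cB _ _ uB vB).
Qed.

Lemma conn_path x p : path e x p -> conn [set z in x :: p].
Proof.
elim: p x => [|y p IH] x /=.
  by move=> _; have := @conn1 x; congr conn; apply/setP => z; rewrite !inE.
case/andP=> exy pth.
have -> : [set z in x :: y :: p] = [set x] :|: [set z in y :: p].
  by apply/setP => z; rewrite !inE.
by apply: (connU (@conn1 x) (IH _ pth) _ _ exy); rewrite !inE eqxx.
Qed.

Lemma conn_uniq_path Q a b : conn Q -> a \in Q -> b \in Q ->
  exists p, [/\ path e a p, last a p = b, uniq (a :: p) & {subset a :: p <= Q}].
Proof.
move=> cQ aQ bQ; case/connectP: (cQ _ _ aQ bQ) => p0 pth0 ->.
case/shortenP: pth0 => p pth up _; exists p; split=> //.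
  by apply: sub_path pth => x y /and3P [].
move: aQ pth {up}; elim: p a => [|y p IH] a aQ /=.
  by move=> _ z; rewrite inE => /eqP ->.
case/andP=> /and3P [_ yQ _] /(IH _ yQ) IHp z; rewrite inE => /predU1P [-> //|].
exact: IHp.
Qed.

Lemma cross_arcs Q x s y t : spread_out -> is_cycle e (x :: s ++ y :: t) ->
  conn Q -> (forall z, z \in Q -> z \notin x :: s ++ y :: t) ->
  touches Q x -> touches Q y ->
  size s < size t -> (size s).+2 < size t.
Proof.
move=> NB cyc cQ dis /touchesP [a aQ exa] /touchesP [b bQ eyb] st.
have [p [pth lp up sp]] := conn_uniq_path cQ aQ bQ.
case/andP: cyc => /andP []; rewrite cycle_glue => /andP [p1 p2] uc _.
have disp z : z \in a :: p -> z \notin x :: s ++ y :: t by move=> /sp /dis.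
have perm : perm_eq (x :: s ++ y :: t) (y :: t ++ x :: s).
  by rewrite -(cat_cons x) -(cat_cons y) perm_catC.
have c2 : is_cycle e (y :: t ++ x :: (a :: p)).
  rewrite /is_cycle /ucycleb cycle_glue p2 /= exa rcons_path pth lp e_sym eyb /=.
  rewrite /= size_cat /= addnS !ltnS addnS ltnS leq0n andbT.
  have : uniq ((y :: t ++ [:: x]) ++ a :: p).
    rewrite cat_uniq up andbT.
    have := uc; rewrite (perm_uniq perm) -(cat1s x) -(cat_cons y) catA cat_uniq.
    rewrite cat_cons => /and3P [-> _ _]; rewrite andTb.
    apply/hasPn => z /disp; apply: contra; rewrite !(inE, mem_cat).
    by case/or3P=> ->; rewrite ?orbT.
  by rewrite cat_cons -catA.
have c1 : is_cycle e (x :: s ++ y :: rev (a :: p)).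
  rewrite /is_cycle /ucycleb cycle_glue p1.
  rewrite [size _]/= size_cat /= size_rev /= addnS !ltnS addnS ltnS leq0n andbT.
  apply/andP; split.
    by rewrite -rev_path_sym /= exa rcons_path pth lp e_sym.
  have : uniq ((x :: s ++ [:: y]) ++ rev (a :: p)).
    rewrite cat_uniq rev_uniq up andbT.
    have := uc; rewrite -(cat1s y) -(cat_cons x) catA cat_uniq.
    rewrite cat_cons => /and3P [-> _ _]; rewrite andTb.
    apply/hasPn => z; rewrite mem_rev => /disp; apply: contra.
    by rewrite !(inE, mem_cat) => /or3P [] ->; rewrite ?orbT.
  by rewrite cat_cons -catA.
have sz1 : size (x :: s ++ y :: rev (a :: p)) = size s + (size p).+3.
  by rewrite /= size_cat /= size_rev /= !addnS.
have sz2 : size (y :: t ++ x :: (a :: p)) = size t + (size p).+3.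
  by rewrite /= size_cat /= !addnS.
by have := NB _ _ c1 c2; rewrite sz1 sz2 ltn_add2r => /(_ st); rewrite -2!addSn ltn_add2r.
Qed.

Lemma nth_rot x0 c i j : i < size c -> j < size c ->
  nth x0 (rot i c) j = nth x0 c ((i + j) %% size c).
Proof.
move=> ic jc; rewrite /rot nth_cat size_drop nth_drop ltn_subRL.
case: ltnP => h; first by rewrite modn_small.
rewrite nth_take; last by lia.
have -> : i + j = (j - (size c - i)) + size c by lia.
by rewrite modnDr modn_small //; lia.
Qed.

(** ** Attachments of a connected set to a cycle *)

Section Attachments.

Variables (c : seq T) (Q X : {set T}) (x0 : T).
Hypotheses (NB : spread_out) (cyc : is_cycle e c) (cQ : conn Q).
Hypotheses (dis : forall z, z \in Q -> z \notin c) (sX : {subset X <= c}).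
Hypothesis (tX : forall x, x \in X -> touches Q x).

Let L := size c.

Let L3 : 2 < L. Proof. by case/andP: cyc. Qed.
Let L0 : 0 < L. Proof. exact: ltn_trans L3. Qed.
Let uc : uniq c. Proof. by case/andP: cyc => /andP []. Qed.

Let shift (d : nat) (i : 'I_L) : 'I_L := Ordinal (ltn_pmod (i + d) L0).

Let I := [set i : 'I_L | nth x0 c i \in X].

Let cardI : #|I| = #|X|.
Proof.
have -> : X = [set nth x0 c (val i) | i in I].
  apply/setP => x; apply/idP/imsetP => [xX|[i]]; last by rewrite inE => ? ->.
  have xc := sX xX; have ix : index x c < L by rewrite index_mem.
  by exists (Ordinal ix); rewrite ?inE /= nth_index.
rewrite card_in_imset // => i j _ _ /eqP.
by rewrite (nth_uniq x0 (ltn_ord i) (ltn_ord j) uc) => /eqP /val_inj.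
Qed.

Let shift_inj d : injective (shift d).
Proof.
move=> i j /(congr1 val) /= /eqP; rewrite eqn_modDr !modn_small // => /eqP.
exact: val_inj.
Qed.

(* The two arcs between positions at this distance differ in length by one or two. *)
Let d := L.-1./2.

Let shift_far i : i \in I -> shift d i \notin I.
Proof.
rewrite !inE => iX; apply/negP => jX.
have d0 : 0 < d by move: L3; rewrite /d; goal_lia.
have dL : d < L by move: L3; rewrite /d; goal_lia.
have := nth_rot x0 (ltn_ord i) dL.
have iE : rot i c = nth x0 c i :: (drop i.+1 c ++ take i c).
  by rewrite /rot (drop_nth x0).
have sz : size (drop i.+1 c ++ take i c) = L.-1.
  by have := size_rot i c; rewrite iE /= /L => /(congr1 predn).
have [d' dE] : exists d', d = d'.+1 by exists d.-1; rewrite prednK.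
rewrite iE dE; move: sz iE; set s := _ ++ _ => sz iE /= nE.
have sE : s = take d' s ++ nth x0 c ((i + d'.+1) %% L) :: drop d'.+1 s.
  by rewrite -nE -drop_nth ?cat_take_drop // sz; move: dE; rewrite /d; goal_lia.
have cyc' : is_cycle e (rot i c) by rewrite rot_is_cycle.
move: cyc'; rewrite iE sE => cyc'.
have := cross_arcs NB cyc' cQ; rewrite -sE -iE.
have dis' : forall z, z \in Q -> z \notin rot i c.
  by move=> z zQ; rewrite mem_rot dis.
move/(_ dis' (tX iX)); move: jX; rewrite /= dE => jX /(_ (tX jX)).
have d'L : d' < L.-1 by move: dE; rewrite /d; goal_lia.
rewrite size_drop size_take sz d'L => far.
by move: dE far; rewrite /d; goal_lia.
Qed.

Let disjoint_shift : [disjoint I & shift d @: I].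
Proof.
rewrite disjoint_sym disjoint_subset; apply/subsetP => _ /imsetP [i iI ->].
exact: shift_far.
Qed.

Let card_shiftU : #|I :|: shift d @: I| = 2 * #|X|.
Proof.
rewrite cardsU disjoint_setI0 // cards0 subn0 card_imset; last exact: shift_inj.
by rewrite cardI mul2n addnn.
Qed.

Lemma attachments_le_half : 2 * #|X| <= size c.
Proof. by rewrite -card_shiftU -[size c]card_ord max_card. Qed.

Hypothesis half : 2 * #|X| = size c.

Let shift_onto i : i \notin I -> exists2 j, j \in I & i = shift d j.
Proof.
have : I :|: shift d @: I = setT.
  by apply/eqP; rewrite eqEcard subsetT cardsT card_ord card_shiftU half leqnn.
move/setP/(_ i); rewrite !inE => /orP [-> //|/imsetP [j jI ->] _].
by exists j.
Qed.

Let shift2 i : i \in I -> shift 2 i \in I.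
Proof.
move=> iI; apply/negPn/negP => /shift_onto [k kI kE].
have iE : shift d (shift d (shift 2 i)) = i.
  apply: val_inj; rewrite /= modnDml -addnA modnDml.
  have -> : i + 2 + (d + d) = i + L by rewrite /d; move: half L3; rewrite -/L; goal_lia.
  by rewrite modnDr modn_small.
have /shift_onto [m mI mE] : shift d (shift 2 i) \notin I.
  by apply/negP => /shift_far; rewrite iE iI.
have kmE : shift 2 i = m by apply: shift_inj mE.
by have := shift_far kI; rewrite -kE kmE mI.
Qed.

Let shift_even i m : i \in I -> shift (2 * m) i \in I.
Proof.
move=> iI; elim: m => [|m IH].
  have -> // : shift (2 * 0) i = i.
  by apply: val_inj; rewrite /= muln0 addn0 modn_small.
have -> : shift (2 * m.+1) i = shift 2 (shift (2 * m) i); last exact: shift2.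
by apply: val_inj; rewrite /= modnDml; congr (_ %% _); goal_lia.
Qed.

Let I0 : #|I| != 0.
Proof. by rewrite cardI; move: L3; rewrite /L -half; goal_lia. Qed.

Lemma attachments_alternate x y t : c = x :: y :: t -> (x \in X) = (y \notin X).
Proof.
move=> cE; have L1 : 1 < L by rewrite /L cE.
pose i0 := Ordinal L0; pose i1 := Ordinal L1.
have x_i0 : (x \in X) = (i0 \in I) by rewrite inE /= cE.
have y_i1 : (y \in X) = (i1 \in I) by rewrite inE /= cE.
have mod2 i : exists m, shift (2 * m) i = i0 \/ shift (2 * m) i = i1.
  exists (#|X| - i./2); have iL := ltn_ord i; have := odd_double_half i.
  case: (odd i) => iE; [right|left]; apply: val_inj => /=.
    have -> : i + 2 * (#|X| - i./2) = 1 + L.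
      by move: iL iE half; rewrite -/L -mul2n; goal_lia.
    by rewrite modnDr modn_small.
  have -> : i + 2 * (#|X| - i./2) = L.
    by move: iL iE half; rewrite -/L -mul2n; goal_lia.
  by rewrite modnn.
have mod2' i : exists m, shift (2 * m) i0 = i \/ shift (2 * m) i1 = i.
  exists i./2; have := odd_double_half i; rewrite -mul2n.
  by case: (odd i) => iE; [right|left]; apply: val_inj; rewrite /= iE modn_small.
rewrite x_i0 y_i1; case: (boolP (i0 \in I)) => h0; case: (boolP (i1 \in I)) => h1 //.
  have IT : I = setT.
    apply/setP => i; rewrite [RHS]inE.
    by case: (mod2' i) => m [] <-; exact: shift_even.
  have := half; rewrite -cardI IT cardsT card_ord -/L; move: L0; goal_lia.
have /set0Pn [i iI] : I != set0 by rewrite -card_gt0 lt0n.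
by case: (mod2 i) => m [] mE; have := shift_even m iI; rewrite mE ?(negbTE h0) ?(negbTE h1).
Qed.

End Attachments.

Lemma back_edge_cycle x p1 y p2 : path e x (p1 ++ y :: p2) ->
  uniq (x :: p1 ++ y :: p2) -> p1 != [::] -> e x y -> is_cycle e (x :: rcons p1 y).
Proof.
rewrite -cat_rcons => pth up p1n exy.
move: pth; rewrite cat_path => /andP [pth _].
have {}up : uniq (x :: rcons p1 y).
  by move: up; rewrite -cat_cons cat_uniq => /and3P [].
rewrite /is_cycle /ucycleb up /= rcons_path pth last_rcons e_sym exy size_rcons.
by case: p1 p1n {pth up}.
Qed.

Lemma extend_to_leaf X x p : ~ has_cycle X -> path e x p -> uniq (x :: p) ->
  {subset x :: p <= X} ->
  exists y q, [/\ path e y q, uniq (y :: q), {subset y :: q <= X},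
    last y q = last x p & (size p <= size q) && (dg X y <= 1)].
Proof.
move=> acyc; have [n] := ubnP (#|X| - size p).
elim: n x p => // n IH x p; rewrite ltnS => szn pth up sp.
case: (boolP [exists y in X, (y \notin x :: p) && e x y]).
  case/exists_inP => y yX /andP [yn exy].
  have pX : size (x :: p) < #|X|.
    have := @uniq_leq_size _ (y :: x :: p) (enum X).
    rewrite -cardE; apply; first by rewrite cons_uniq yn up.
    by move=> z; rewrite mem_enum inE => /predU1P [-> //|/sp].
  case: (IH y (x :: p)).
  - by move: pX szn => /=; goal_lia.
  - by rewrite /= e_sym exy.
  - by rewrite cons_uniq yn up.
  - by move=> z; rewrite inE => /predU1P [-> //|/sp].
  move=> y' [q [pq uq sq lq /andP [szq dq]]]; exists y', q; split=> //.
  by rewrite (ltnW szq).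
move=> /exists_inPn stuck; exists x, p; split=> //; rewrite leqnn /=.
apply: leq_trans (_ : #|[set head x p]| <= 1); last by rewrite cards1.
apply: subset_leq_card; apply/subsetP => y; rewrite !inE => /andP [yX exy].
have := stuck _ yX; rewrite exy andbT negbK inE => /predU1P [yx|].
  by move: exy; rewrite yx e_irr.
move=> yp; case/splitPr: yp pth up sp {stuck szn} => -[|z p1] p2 //= pth up sp.
case: acyc; exists (x :: rcons (z :: p1) y); first exact: (@back_edge_cycle x (z :: p1) y p2).
by move=> w wc; apply: sp; rewrite -(cat_cons z) -cat_rcons -cat_cons mem_cat wc.
Qed.

Lemma acyclic_leaf X : ~ has_cycle X -> X != set0 -> exists2 v, v \in X & dg X v <= 1.
Proof.
move=> acyc /set0Pn [x xX].
have sx : {subset [:: x] <= X} by move=> z; rewrite inE => /eqP ->.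
case: (@extend_to_leaf X x [::]) => // y [q [_ _ sq _ /andP [_ dy]]].
by exists y => //; apply: sq; rewrite inE eqxx.
Qed.

Lemma has_cycle_sub A B : A \subset B -> has_cycle A -> has_cycle B.
Proof. by move=> /subsetP AB [c cyc sc]; exists c => // z /sc /AB. Qed.

Lemma dgD1 A v w : v \in A -> dg A w = dg (A :\ v) w + e w v.
Proof.
move=> vA; rewrite /dg (cardsD1 v) inE vA addnC; congr (_ + _).
by apply: eq_card => z; rewrite !inE andbA.
Qed.

Lemma dg_sum A v : dg A v = \sum_(w in A) e v w.
Proof.
by rewrite /dg -sum1dep_card big_mkcondr /=; apply: eq_bigr => w _; case: (e v w).
Qed.

Lemma dg_sub A B v : A \subset B -> dg A v <= dg B v.
Proof.
move=> /subsetP AB; apply: subset_leq_card; apply/subsetP => z.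
by rewrite !inE => /andP [/AB -> ->].
Qed.

Lemma sum_dgD1 A v : v \in A ->
  \sum_(w in A) dg A w = (dg A v).*2 + \sum_(w in A :\ v) dg (A :\ v) w.
Proof.
move=> vA; rewrite (big_setD1 v) //=.
rewrite (eq_bigr (fun w => dg (A :\ v) w + e v w)); last first.
  by move=> w _; rewrite [e v w]e_sym -dgD1.
by rewrite big_split /= -dg_sum [dg A v](dgD1 _ vA) e_irr addn0 -addnn addnA addnAC.
Qed.

Lemma acyclic_sum_dg X : ~ has_cycle X -> X != set0 ->
  \sum_(v in X) dg X v + 2 <= 2 * #|X|.
Proof.
have [n] := ubnP #|X|; elim: n X => // n IH X; rewrite ltnS => Xn acyc Xn0.
have [v vX dv] := acyclic_leaf acyc Xn0.
have cX := cardsD1 v X; rewrite vX in cX.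
rewrite (sum_dgD1 vX).
have [X0|X1] := eqVneq (X :\ v) set0.
  rewrite X0 big_set0 cX X0 cards0.
  have -> : dg X v = 0; last by [].
  by rewrite dg_sum (big_setD1 v) //= e_irr X0 big_set0.
have := IH (X :\ v); move: Xn0 => _.
have lt : #|X :\ v| < n by move: Xn; rewrite cX add1n.
move/(_ lt (fun h => acyc (has_cycle_sub (subsetDl _ _) h)) X1).
by move: dv; rewrite cX; goal_lia.
Qed.

Lemma cycle_of_min_dg X : X != set0 -> (forall v, v \in X -> 1 < dg X v) -> has_cycle X.
Proof.
move=> X0 dX; apply: NNPP => /acyclic_leaf /(_ X0) [v vX].
by rewrite leqNgt dX.
Qed.

Lemma cycle_dg c v : is_cycle e c -> v \in c -> 1 < dg [set x in c] v.
Proof.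
move=> cyc vc; have [i s sE] := rot_to vc.
have memE : c =i v :: s by move=> z; rewrite -sE mem_rot.
move: cyc; rewrite -(rot_is_cycle i) sE => /andP [/andP [cs us] sz].
case: s sE memE cs us sz => [|x [|y s]] //= _ memE; rewrite !rcons_path.
move=> /andP [evx /andP [_ /andP [_ ely]]] us _.
apply: leq_trans (_ : #|[set x; last y s]| <= _).
  rewrite cards2; case: eqVneq => // xl.
  by move: us; rewrite xl mem_last !andbF.
apply: subset_leq_card; apply/subsetP => z; rewrite !inE memE.
case/orP => /eqP ->; first by rewrite evx !inE eqxx orbT.
by rewrite [e v _]e_sym ely !in_cons -in_cons mem_last !orbT.
Qed.

Lemma seq_argmin (P : seq T -> Prop) c0 : P c0 ->
  exists2 c, P c & forall c', P c' -> size c <= size c'.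
Proof.
have [n] := ubnP (size c0); elim: n c0 => // n IH c0; rewrite ltnS => c0n Pc0.
case: (classic (exists2 c, P c & size c < size c0)) => [[c Pc lt]|min].
  by apply: IH Pc; apply: leq_trans lt c0n.
exists c0 => // c' Pc'; rewrite leqNgt; apply/negP => lt.
by apply: min; exists c'.
Qed.

Definition shortest_in A c :=
  [/\ is_cycle e c, {subset c <= A} &
      forall c', is_cycle e c' -> {subset c' <= A} -> size c <= size c'].

Lemma exists_shortest A : has_cycle A -> exists c, shortest_in A c.
Proof.
case=> c0 cyc0 sub0.
have [//|c [cyc sub] min] := @seq_argmin (fun c => is_cycle e c /\ {subset c <= A}) c0.
by exists c; split=> // c' cyc' sub'; exact: min.
Qed.

Lemma shortest_rot A c i : shortest_in A c -> shortest_in A (rot i c).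
Proof.
case=> cyc sub min; split; rewrite ?rot_is_cycle ?size_rot //.
by move=> z; rewrite mem_rot => /sub.
Qed.

Lemma shortest_chordless A c v : shortest_in A c -> v \in c ->
  dg [set x in c] v <= 2.
Proof.
move=> sh vc; have [i s sE] := rot_to vc.
have memE : c =i v :: s by move=> z; rewrite -sE mem_rot.
have := shortest_rot i sh; rewrite sE => -[/andP [/andP [cs us] sz] sub min].
apply: leq_trans (_ : #|[set head v s; last v s]| <= 2).
  apply: subset_leq_card; apply/subsetP => z; rewrite !inE memE inE.
  case/andP => /predU1P [->|zs evz]; first by rewrite e_irr.
  case/splitPr: zs cs us sz sub min {sE memE} => -[|a p1] [|b p2] //=; rewrite ?eqxx //.
    by rewrite last_cat eqxx orbT.
  move=> cs us _ sub min.
  have cyc : is_cycle e (v :: rcons (a :: p1) z).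
    apply: (@back_edge_cycle v (a :: p1) z (b :: p2)) => //.
    by case/andP: cs => /= -> ; rewrite rcons_path => /andP [].
  have := min _ cyc; rewrite /= !size_cat /= size_rcons.
  suff sub' : {subset v :: rcons (a :: p1) z <= A} by move/(_ sub'); goal_lia.
  move=> w wc; apply: sub; rewrite -(cat_cons a) -cat_rcons -cat_cons mem_cat.
  by rewrite wc.
by rewrite cards2; case: eqP.
Qed.

Lemma shortest_no3_ordered A x u1 s1 u2 s2 u3 s3 : spread_out ->
  shortest_in A (u1 :: s1 ++ u2 :: s2 ++ u3 :: s3) -> x \in A ->
  x \notin u1 :: s1 ++ u2 :: s2 ++ u3 :: s3 -> e x u1 -> e x u2 -> ~ e x u3.
Proof.
move=> NB sh xA xn e1 e2 e3.
have short a p b q : shortest_in A (a :: p ++ b :: q) -> e x a -> e x b ->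
    x \notin a :: p ++ b :: q -> is_cycle e (x :: rcons (a :: p) b) /\ size q <= 1.
  move=> [/andP [/andP [cs us] sz] sub min] ea eb xn'.
  have cyc : is_cycle e (x :: rcons (a :: p) b).
    apply: (@back_edge_cycle x (a :: p) b q) => //.
      by move: cs; rewrite [cycle _ _]/= rcons_path /= ea => /andP [].
    by rewrite cons_uniq xn' us.
  split=> //; have := min _ cyc; rewrite /= !size_cat /= size_rcons.
  have sub' : {subset x :: rcons (a :: p) b <= A}.
    move=> w; rewrite inE => /predU1P [-> //|wc]; apply: sub.
    by rewrite -cat_cons -cat_rcons mem_cat wc.
  by move/(_ sub'); goal_lia.
have rotE : rot (size s1).+1 (u1 :: s1 ++ u2 :: s2 ++ u3 :: s3) =
    u2 :: s2 ++ u3 :: s3 ++ u1 :: s1.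
  by rewrite -cat_cons -[_.+1]/(size (u1 :: s1)) rot_size_cat /= -catA.
have sh' := shortest_rot (size s1).+1 sh.
have xn' : x \notin rot (size s1).+1 (u1 :: s1 ++ u2 :: s2 ++ u3 :: s3).
  by rewrite mem_rot.
rewrite rotE in sh' xn'.
have [c1 sz1] := short _ _ _ _ sh e1 e2 xn.
have [c2 sz2] := short _ _ _ _ sh' e2 e3 xn'.
have s1n : s1 = [::] by move: sz2; rewrite size_cat /=; case: (s1) => //=; goal_lia.
have s2n : s2 = [::] by move: sz1; rewrite size_cat /=; case: (s2) => //=; goal_lia.
subst s1 s2; have [c3 _] := short u1 [:: u2] u3 s3 sh e1 e3 xn.
by have := NB _ _ c1 c3 isT.
Qed.

Lemma shortest_dg_out A c x : spread_out -> shortest_in A c -> x \in A -> x \notin c ->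
  dg [set z in c] x <= 2.
Proof.
move=> NB sh xA xn; rewrite leqNgt; apply/negP => /card_gt2P [u1 [u2 [u3 []]]].
rewrite !inE => -[/andP [c1 e1] /andP [c2 e2] /andP [c3 e3]] [n12 n23 n31].
have [i s sE] := rot_to c1.
have {}sh := shortest_rot i sh; have {}xn : x \notin rot i c by rewrite mem_rot.
have {}c2 : u2 \in s by move: c2; rewrite -(mem_rot i) sE inE eq_sym (negbTE n12).
have {}c3 : u3 \in s by move: c3; rewrite -(mem_rot i) sE inE (negbTE n31).
rewrite sE in sh xn.
case/splitPr: c2 sh xn c3 {sE} => p1 p2 sh xn.
rewrite mem_cat inE eq_sym (negbTE n23) /= => /orP [] c3.
  case/splitPr: c3 sh xn => q1 q2; rewrite -catA cat_cons => sh xn.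
  exact: shortest_no3_ordered NB sh xA xn e1 e3 e2.
case/splitPr: c3 sh xn => q1 q2 sh xn.
exact: shortest_no3_ordered NB sh xA xn e1 e2 e3.
Qed.

Definition maximal_avoiding Z F := [/\ F \subset Z, conn F, has_cycle (Z :\: F) &
  forall y, y \in Z :\: F -> touches F y -> ~ has_cycle (Z :\: F :\ y)].

Lemma exists_maximal_avoiding Z F0 : F0 \subset Z -> conn F0 -> has_cycle (Z :\: F0) ->
  exists2 F : {set T}, F0 \subset F & maximal_avoiding Z F.
Proof.
have [n] := ubnP #|Z :\: F0|; elim: n F0 => // n IH F0; rewrite ltnS => F0n FZ cF hc.
case: (classic (exists y, [/\ y \in Z :\: F0, touches F0 y & has_cycle (Z :\: F0 :\ y)])).
  case=> y [yZ /touchesP [f fF eyf] hcy].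
  have DE : Z :\: (y |: F0) = Z :\: F0 :\ y.
    by apply/setP => z; rewrite !inE negb_or -andbA.
  case: (IH (y |: F0)).
  - rewrite DE; apply: leq_trans F0n.
    by rewrite (cardsD1 y (Z :\: F0)) yZ.
  - by rewrite subUset FZ andbT sub1set; move: yZ; rewrite inE => /andP [].
  - by apply: (connU (@conn1 y) cF _ fF eyf); rewrite inE.
  - by rewrite DE.
  by move=> F sF mF; exists F => //; apply: subset_trans sF; exact: subsetUr.
move=> nex; exists F0 => //; split=> // y yZ ty hcy.
by apply: nex; exists y.
Qed.

Lemma acyclic_deletions_sum_dg R Y : Y \subset R -> 1 < #|Y| ->
  (forall y, y \in Y -> ~ has_cycle (R :\ y)) -> (forall y, y \in Y -> 1 < dg R y) ->
  \sum_(v in R :\: Y) dg R v <= 2 * #|R :\: Y|.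
Proof.
move=> YR Y1 acyc dY.
have /set0Pn [y0 y0Y] : Y != set0 by rewrite -card_gt0; move: Y1; goal_lia.
case: (@arg_minnP _ y0 (mem Y) (dg R) y0Y) => y yY ymin.
have {}yY : y \in Y := yY.
have yR := subsetP YR _ yY.
have RyN : R :\ y != set0.
  rewrite -card_gt0; have := subset_leq_card YR; rewrite (cardsD1 y R) yR; move: Y1; goal_lia.
have := acyclic_sum_dg (acyc _ yY) RyN.
have := sum_dgD1 yR; rewrite (big_setD1 y) //=.
rewrite [\sum_(w in R :\ y) dg R w](bigID (mem Y)) /=.
have -> : \sum_(i in R :\ y | i \notin Y) dg R i = \sum_(v in R :\: Y) dg R v.
  apply: eq_bigl => z; rewrite !inE; case: eqP => [->|]; first by rewrite yY.
  by rewrite andbC.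
have -> : \sum_(i in R :\ y | i \in Y) dg R i = \sum_(v in Y :\ y) dg R v.
  apply: eq_bigl => z; rewrite !inE -andbA; case: (boolP (z \in Y)) => zY; last by rewrite !andbF.
  by rewrite (subsetP YR _ zY).
have YE : #|Y| = 1 + #|Y :\ y| by rewrite (cardsD1 y Y) yY.
have RE : #|R| = 1 + #|R :\ y| by rewrite (cardsD1 y R) yR.
have DE : #|R :\: Y| = #|R| - #|Y| by rewrite cardsD (setIidPr YR).
have YRle := subset_leq_card YR.
have /set0Pn [y1 y1Y] : Y :\ y != set0 by rewrite -card_gt0; move: Y1 YE; goal_lia.
have : dg R y + 2 * #|Y :\ y| <= \sum_(v in Y :\ y) dg R v + 2.
  rewrite (big_setD1 y1) //= (cardsD1 y1 (Y :\ y)) y1Y.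
  have : dg R y <= dg R y1 by apply: ymin; move: y1Y; rewrite !inE => /andP [].
  have : 2 * #|Y :\ y :\ y1| <= \sum_(v in Y :\ y :\ y1) dg R v.
    rewrite mulnC -sum_nat_const; apply: leq_sum => v; rewrite !inE => /and3P [_ _ vY].
    exact: dY.
  goal_lia.
move: DE YE RE YRle; rewrite -!mul2n; goal_lia.
Qed.

(** ** Maximal connected sets avoiding a cycle *)

Definition rim Z F := [set y in Z :\: F | touches F y].

Lemma rim_sub Z F : rim Z F \subset Z :\: F.
Proof. by apply/subsetP => y; rewrite inE => /andP []. Qed.

Lemma dg_setID A B v : B \subset A -> dg A v = dg B v + dg (A :\: B) v.
Proof.
move=> BA; rewrite /dg -(cardsID B [set w in A | e v w]); congr (_ + _).
  apply: eq_card => w; rewrite !inE; case: (boolP (w \in B)) => wB.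
    by rewrite (subsetP BA) // andbT.
  by rewrite andbF.
by apply: eq_card => w; rewrite !inE andbA.
Qed.

Lemma dg_gt0P A v : reflect (exists2 w, w \in A & e v w) (0 < dg A v).
Proof.
rewrite /dg card_gt0; apply: (iffP (set0Pn _)) => [[w]|[w wA evw]].
  by rewrite inE => /andP [wA evw]; exists w.
by exists w; rewrite inE wA.
Qed.

Lemma sum_indicator A B : A \subset B -> \sum_(v in B) (v \in A) = #|A|.
Proof.
move=> AB; rewrite -sum1_card big_mkcond [RHS]big_mkcond /=.
apply: eq_bigr => v _; case: (boolP (v \in A)) => [vA|]; last by case: ifP.
by rewrite (subsetP AB).
Qed.

Lemma eq_of_leq_sum (A : {set T}) (f g : T -> nat) :
  (forall v, v \in A -> f v <= g v) -> \sum_(v in A) g v <= \sum_(v in A) f v ->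
  forall v, v \in A -> f v = g v.
Proof.
move=> fg le v vA; apply/eqP; rewrite eqn_leq fg //= leqNgt; apply/negP => lt.
move: le; rewrite leqNgt (big_setD1 v) //= [ltnRHS](big_setD1 v) //=.
rewrite -addSn leq_add //.
by apply: leq_sum => w /setD1P [_ /fg].
Qed.

Lemma rim_dg Z F y : maximal_avoiding Z F -> y \in rim Z F -> 2 < dg Z y.
Proof.
case=> FZ _ [c cyc sc] mx; rewrite inE => /andP [yR ty].
have yc : y \in c.
  apply/negPn/negP => yc; apply: (mx y yR ty); exists c => // z zc.
  by rewrite in_setD1 sc // andbT; apply: contraNneq yc => <-.
have d2 : 1 < dg (Z :\: F) y.
  apply: leq_trans (cycle_dg cyc yc) _; apply: dg_sub.
  by apply/subsetP => z; rewrite inE => /sc.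
rewrite (dg_setID _ FZ); have dF : 0 < dg F y by apply/dg_gt0P/touchesP.
by move: d2 dF; goal_lia.
Qed.

Lemma not_rim_dg Z F v : F \subset Z -> v \in Z :\: F -> v \notin rim Z F ->
  dg Z v = dg (Z :\: F) v.
Proof.
move=> FZ vR; rewrite inE vR /= => nt; rewrite (dg_setID _ FZ).
have -> // : dg F v = 0.
by apply/eqP; rewrite -leqn0 leqNgt; apply: contra nt => /dg_gt0P /touchesP.
Qed.

Section Ear.

Variables (Z F : {set T}) (c : seq T).
Let R := Z :\: F.
Let Y := rim Z F.
Let C := [set x in c].
Let B := R :\: Y.
Let S := small Z :&: R.

Hypotheses (NB : spread_out) (mF : maximal_avoiding Z F) (sh : shortest_in R c).
Hypothesis Y2 : 1 < #|Y|.
Hypothesis dg_pos : forall v, v \in R -> 0 < dg Z v.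

Let cyc : is_cycle e c. Proof. by case: sh. Qed.
Let cR : C \subset R. Proof. by case: sh => _ sub _; apply/subsetP => z; rewrite inE => /sub. Qed.
Let YR : Y \subset R. Proof. exact: rim_sub. Qed.
Let FZ : F \subset Z. Proof. by case: mF. Qed.

Let cardC : #|C| = size c.
Proof. by case/andP: cyc => /andP [_ uc] _; rewrite cardsE; apply/card_uniqP. Qed.

Lemma rim_on_cycle : {subset Y <= c}.
Proof.
case: mF => _ _ _ mx y; rewrite inE => /andP [yR ty].
apply/negPn/negP => yc; apply: (mx y yR ty); exists c => // z zc.
rewrite in_setD1 (subsetP cR) ?inE // andbT; apply: contraNneq yc => <- //.
Qed.

Let YC : Y \subset C.
Proof. by apply/subsetP => y /rim_on_cycle; rewrite inE. Qed.

Let c_gt0 : 0 < size c. Proof. by case/andP: cyc => _; apply: ltn_trans. Qed.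

Let F_off z : z \in F -> z \notin c.
Proof.
move=> zF; apply/negP => zc.
by have := subsetP cR z; rewrite !inE zF zc => /(_ isT).
Qed.

Lemma rim_le_half : 2 * #|Y| <= size c.
Proof.
have [x0 _] : exists x0, x0 \in c by case: (c) c_gt0 => // x s _; exists x; rewrite inE eqxx.
have cF : conn F by case: mF.
apply: (attachments_le_half x0 NB cyc cF F_off rim_on_cycle).
by move=> y; rewrite inE => /andP [].
Qed.

Let dgB v : v \in B -> dg Z v = dg R v.
Proof. by rewrite inE => /andP [vY vR]; apply: not_rim_dg. Qed.

Let inS v : v \in B -> (v \in S) = (dg R v < 3).
Proof.
move=> vB; rewrite -dgB // in_setI; move: vB; rewrite in_setD => /andP [_ vR].
by rewrite vR andbT inE (subsetP (subsetDl Z F) _ vR).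
Qed.

Let SB : S \subset B.
Proof.
apply/subsetP => v; rewrite in_setI => /andP [vS vR]; rewrite in_setD vR andbT.
apply: contraL vS => /(rim_dg mF); rewrite inE => d3.
by rewrite ltnNge d3 andbF.
Qed.

(* Minimal possible degrees in R of the vertices of B. *)
Let w v := if v \in S then (if v \in C then 2 else 1) else 3.

Let w_le_dg v : v \in B -> w v <= dg R v.
Proof.
move=> vB; rewrite /w; case: ifP => [vS|]; last by rewrite inS // ltnNge => /negbFE.
case: ifP => [|_]; last first.
  by rewrite -dgB //; apply: dg_pos; move: vB; rewrite in_setD => /andP [].
rewrite inE => vc; apply: leq_trans (cycle_dg cyc vc) _.
exact: dg_sub.
Qed.

Let N := B :\: S.
Let O := S :\: C.

Let sum_w : \sum_(v in B) w v + #|O| = 2 * #|B| + #|N|.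
Proof.
have OB : O \subset B by apply: subset_trans SB; exact: subsetDl.
rewrite -(sum_indicator OB) -(sum_indicator (subsetDl B S : N \subset B)).
rewrite mulnC -sum_nat_const -!big_split /=; apply: eq_bigr => v vB.
rewrite /w [v \in O]in_setD [v \in N]in_setD vB andbT.
by case: (v \in S); case: (v \in C).
Qed.

Let sum_dg : \sum_(v in B) dg R v <= 2 * #|B|.
Proof.
apply: acyclic_deletions_sum_dg => // y yY.
  by case: mF => _ _ _; apply; move: yY; rewrite inE => /andP [].
apply: leq_trans (cycle_dg cyc (rim_on_cycle yY)) _.
exact: dg_sub.
Qed.

Let sum_w_le : \sum_(v in B) w v <= \sum_(v in B) dg R v.
Proof. exact: leq_sum. Qed.

Let N_le_O : #|N| <= #|O|.
Proof. by move: sum_w sum_dg sum_w_le; goal_lia. Qed.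

Let cardS : #|S| = #|S :&: C| + #|O|. Proof. by rewrite cardsID. Qed.

Let cardB : #|B| = #|S| + #|N|.
Proof. by rewrite [#|N|]cardsD (setIidPr SB) subnKC // subset_leq_card. Qed.

Let cardCY : #|C :\: Y| = #|S :&: C| + #|N :&: C|.
Proof.
rewrite -(cardsID S (C :\: Y)); congr (_ + _); apply: eq_card => v.
  rewrite in_setI [v \in S :&: C]in_setI [v \in C :\: Y]in_setD andbC.
  have [vS|//] := boolP (v \in S); congr (_ && _).
  by have := subsetP SB v vS; rewrite in_setD => /andP [-> _].
rewrite in_setD [v \in C :\: Y]in_setD [v \in N :&: C]in_setI [v \in N]in_setD.
rewrite [v \in B]in_setD; have [vC|_] := boolP (v \in C); last by rewrite !andbF.
by rewrite (subsetP cR v vC) !andbT.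
Qed.

Let size_c : size c = #|Y| + #|C :\: Y|.
Proof. by rewrite -cardC cardsD (setIidPr YC) subnKC // subset_leq_card. Qed.

Let NC_le : #|N :&: C| <= #|N|. Proof. exact: subset_leq_card (subsetIl _ _). Qed.

Lemma rim_le_small : #|Y| <= #|S|.
Proof. by move: rim_le_half size_c cardCY cardS N_le_O NC_le; goal_lia. Qed.

Lemma ear_le_small : #|B| <= 2 * #|S|.
Proof. by move: cardB cardS N_le_O; goal_lia. Qed.

Hypothesis tight : #|Y| = #|S|.

Lemma tight_half : 2 * #|Y| = size c.
Proof. by move: rim_le_half size_c cardCY cardS N_le_O NC_le tight; goal_lia. Qed.

Let card_NO : #|N| = #|O|.
Proof. by move: rim_le_half size_c cardCY cardS N_le_O NC_le tight; goal_lia. Qed.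

Let NC : N \subset C.
Proof.
have : N :&: C == N.
  rewrite eqEcard subsetIl /=.
  by move: rim_le_half size_c cardCY cardS N_le_O NC_le tight; goal_lia.
by move/eqP <-; exact: subsetIr.
Qed.

Let dg_w v : v \in B -> w v = dg R v.
Proof.
move: v; apply: eq_of_leq_sum => //.
by move: sum_w sum_dg card_NO; goal_lia.
Qed.

Let dgO v : v \in O -> dg R v = 1.
Proof.
rewrite in_setD => /andP [vC vS].
by rewrite -dg_w ?(subsetP SB) // /w vS (negbTE vC).
Qed.

Let dgN v : v \in N -> dg (R :\: C) v = 1.
Proof.
move=> vN; have vc : v \in c by have := subsetP NC v vN; rewrite inE.
have : dg R v = 3.
  by move: vN; rewrite in_setD => /andP [vS vB]; rewrite -dg_w // /w (negbTE vS).
rewrite (dg_setID _ cR).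
have := shortest_chordless sh vc; have := cycle_dg cyc vc; rewrite -/C; goal_lia.
Qed.

Let N_pendant x : x \in N -> exists2 v, v \in O & e x v.
Proof.
move=> xN; have : 0 < dg (R :\: C) x by rewrite dgN.
case/dg_gt0P => v; rewrite in_setD => /andP [vC vR] exv; exists v => //.
have vY : v \notin Y by apply: contra vC; exact: (subsetP YC).
have vB : v \in B by rewrite in_setD vY.
rewrite in_setD vC; apply: contraR vC => vS; apply: (subsetP NC).
by rewrite in_setD vS.
Qed.

Let pendant_of x := odflt x [pick v in O | e x v].

Let pendant_ofP x : x \in N -> pendant_of x \in O /\ e x (pendant_of x).
Proof.
move=> /N_pendant [v vO exv]; rewrite /pendant_of; case: pickP => [u /andP [] //|].
by move/(_ v); rewrite vO exv.
Qed.

Let NR : N \subset R. Proof. exact: subset_trans NC cR. Qed.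

Let O_pendant v : v \in O -> exists2 x, x \in N & e x v.
Proof.
have inj : {in N &, injective pendant_of}.
  move=> x x' xN x'N xx'; have [vO exv] := pendant_ofP xN.
  have [_ exv'] := pendant_ofP x'N; rewrite -xx' in exv'.
  have /eq_leq/card_le1_eqP h := dgO vO.
  by apply: h; rewrite inE [e _ _]e_sym ?exv ?exv' ?andbT; exact: (subsetP NR).
have : pendant_of @: N = O.
  apply/eqP; rewrite eqEcard card_in_imset // card_NO leqnn andbT.
  by apply/subsetP => _ /imsetP [x xN ->]; case: (pendant_ofP xN).
move=> <- /imsetP [x xN ->]; exists x => //.
by case: (pendant_ofP xN).
Qed.

Lemma tight_roots : exists2 r : T -> T, {in S &, injective r} &
  forall v, v \in S -> [/\ r v \in c, r v \notin Y &
    (v \in c) && (r v == v) || (v \notin c) && e v (r v)].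
Proof.
pose r v := if v \in C then v else odflt v [pick x in N | e x v].
have rO v : v \in O -> r v \in N /\ e (r v) v.
  move=> vO; have [x xN exv] := O_pendant vO.
  rewrite /r; move: vO; rewrite in_setD => /andP [/negbTE -> _].
  by case: pickP => [u /andP [] //|/(_ x)]; rewrite xN exv.
have rC v : v \in C -> r v = v by rewrite /r => ->.
exists r => [v v' vS v'S rr|v vS].
  have [vC|vC] := boolP (v \in C); have [v'C|v'C] := boolP (v' \in C).
  - by move: rr; rewrite !rC.
  - have [] := rO v'; first by rewrite in_setD v'C.
    by rewrite -rr rC // in_setD vS.
  - have [] := rO v; first by rewrite in_setD vC.
    by rewrite rr rC // in_setD v'S.
  have [rN er] : r v \in N /\ e (r v) v by apply: rO; rewrite in_setD vC.
  have [_ er'] : r v' \in N /\ e (r v') v' by apply: rO; rewrite in_setD v'C.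
  have /eq_leq/card_le1_eqP h := dgN rN.
  have SR u : u \in S -> u \in R by rewrite in_setI => /andP [].
  by apply: h; rewrite inE in_setD ?vC ?v'C SR // ?rr ?er' // -rr.
have [vC|vC] := boolP (v \in C).
  have vc : v \in c by move: vC; rewrite inE.
  rewrite rC // vc eqxx; split=> //.
  by have := subsetP SB v vS; rewrite in_setD => /andP [].
have [rN er] : r v \in N /\ e (r v) v by apply: rO; rewrite in_setD vC.
have vc : v \notin c by move: vC; rewrite inE.
rewrite (negbTE vc) /= e_sym er; split=> //.
  by have := subsetP NC _ rN; rewrite inE.
by have := rN; rewrite !in_setD => /and3P [].
Qed.

End Ear.

Lemma attachments_two_steps c Q X x : spread_out -> is_cycle e c -> conn Q ->
  (forall z, z \in Q -> z \notin c) -> {subset X <= c} ->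
  (forall z, z \in X -> touches Q z) -> 2 * #|X| = size c -> x \in X ->
  exists a y, [/\ a \in c, a \notin X, y \in X, y != x & e x a && e a y].
Proof.
move=> NB cyc cQ dis sX tX half xX; have [i s sE] := rot_to (sX _ xX).
have cyc' := cyc; rewrite -(rot_is_cycle i) sE in cyc'.
have memE z : (z \in c) = (z \in x :: s) by rewrite -sE mem_rot.
have szE : size c = (size s).+1 by rewrite -(size_rot i) sE.
case: s => [|a [|y s]] in sE cyc' memE szE; try by case/andP: cyc'.
have disE z : z \in Q -> z \notin x :: a :: y :: s by move/dis; rewrite memE.
have sXE : {subset X <= x :: a :: y :: s} by move=> z /sX; rewrite memE.
have aX : a \notin X.
  have := attachments_alternate x NB cyc' cQ disE sXE tX.
  by rewrite half szE => /(_ erefl _ _ _ erefl); rewrite xX => <-.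
have yX : y \in X.
  have cyc2 : is_cycle e (a :: y :: rcons s x).
    by rewrite -(rot_is_cycle 1) in cyc'; rewrite rot1_cons in cyc'.
  have mem2 z : (z \in x :: a :: y :: s) = (z \in a :: y :: rcons s x).
    by rewrite -!rcons_cons mem_rcons.
  have dis2 z : z \in Q -> z \notin a :: y :: rcons s x by move/disE; rewrite mem2.
  have sX2 : {subset X <= a :: y :: rcons s x} by move=> z /sXE; rewrite mem2.
  have := attachments_alternate x NB cyc2 cQ dis2 sX2 tX.
  rewrite half szE /= size_rcons => /(_ erefl _ _ _ erefl).
  by rewrite (negbTE aX) => /esym/negbFE.
exists a, y; rewrite memE !inE eqxx orbT aX yX; split=> //.
  by case/andP: cyc' => /andP [_]; rewrite /= !inE !negb_or [y == x]eq_sym => /andP [/and3P [_ ->]].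
by case/andP: cyc' => /andP [/= /and3P [-> -> _]].
Qed.

Section Detour.

Variables (F Y : {set T}).
Hypotheses (NB : spread_out) (cF : conn F).
Hypothesis tY : forall y, y \in Y -> touches F y.

Lemma no_outer_link c x a m : is_cycle e c -> (forall z, z \in F -> z \notin c) ->
  {subset Y <= c} -> 2 * #|Y| = size c -> x \in c -> x \notin Y ->
  path e x (a :: m) -> (forall z, z \in a :: m -> z \notin c) ->
  ~~ touches F (last x (a :: m)).
Proof.
move=> cyc dis sY half xc xY /= /andP [exa pm] mc; apply/negP => /touchesP [f fF elf].
have cm := conn_path pm.
have lm : last a m \in [set z in a :: m] by rewrite inE mem_last.
have cQ := connU cm cF lm fF elf.
have := attachments_le_half x (X := x |: Y) NB cyc cQ.
rewrite cardsU1 xY mulnDr half => /(_ _ _ _) h.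
suff : 2 * true + size c <= size c by rewrite leqNgt -[ltnLHS]add0n ltn_add2r.
apply: h.
- by move=> z; rewrite inE => /orP [|/dis //]; rewrite inE => /mc.
- by move=> z /setU1P [->|/sY].
move=> z /setU1P [->|/tY /touchesP [q qF ezq]]; apply/touchesP.
  by exists a => //; rewrite !inE eqxx.
by exists q => //; rewrite inE qF orbT.
Qed.

Lemma no_arc_detour x s y t m : is_cycle e (x :: s ++ y :: t) ->
  (forall z, z \in F -> z \notin x :: s ++ y :: t) ->
  {subset Y <= x :: s ++ y :: t} -> 2 * #|Y| = size (x :: s ++ y :: t) ->
  x \notin Y -> y \notin Y ->
  path e x (rcons m y) -> uniq m -> 0 < size m <= 3 ->
  (forall z, z \in m -> (z \notin x :: s ++ y :: t) && (z \notin F)) ->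
  size s < 2 * #|Y :&: [set z in s]| -> False.
Proof.
move=> cyc dis sY half xY yY pm um szm mc big.
have rotE : rot (size (x :: s)) (x :: s ++ y :: t) = y :: t ++ x :: s.
  by rewrite -cat_cons rot_size_cat.
have cyc' : is_cycle e (y :: t ++ x :: s) by rewrite -rotE rot_is_cycle.
have mem' z : (z \in y :: t ++ x :: s) = (z \in x :: s ++ y :: t) by rewrite -rotE mem_rot.
have sz' : size (y :: t ++ x :: s) = size (x :: s ++ y :: t) by rewrite -rotE size_rot.
have alt a r : t ++ x :: s = a :: r -> a \in Y.
  move=> tE; have := attachments_alternate x (c := y :: t ++ x :: s) (X := Y) NB cyc' cF.
  have dis' z : z \in F -> z \notin y :: t ++ x :: s by rewrite mem'; exact: dis.
  have sY' : {subset Y <= y :: t ++ x :: s} by move=> z /sY; rewrite mem'.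
  rewrite half sz' tE => /(_ _ _ tY erefl y a r erefl) h; rewrite tE in dis' sY'.
  by move: (h dis' sY'); rewrite (negbTE yY) => /esym/negbFE.
case: t => [|b t] in cyc dis sY half mc rotE cyc' mem' sz' alt *.
  by move: xY; rewrite (alt x s).
have bY : b \in Y by exact: alt.
have /andP [/andP [cc uc] sc] := cyc.
move: cc; rewrite cycle_glue => /andP [p1 p2].
pose Q := [set z in b :: t] :|: F.
have /touchesP [f fF ebf] := tY bY.
have bt : b \in [set z in b :: t] by rewrite !inE eqxx.
have cQ : conn Q.
  apply: connU bt fF ebf => //; apply: conn_path.
  by move: p2; rewrite rcons_cons /= rcons_path => /and3P [].
have tQ z : touches [set z in b :: t] z || touches F z -> touches Q z.
  case/orP=> /touchesP [q qQ ezq]; apply/touchesP; exists q => //; rewrite inE qQ ?orbT //.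
pose X := x |: (y |: (Y :&: [set z in s])).
have [xs xny ys] : [/\ x \notin s, x != y & y \notin s].
  move: uc; rewrite cons_uniq mem_cat inE !negb_or => /andP [/and3P [-> -> _]].
  by rewrite cat_uniq => /and3P [_ /norP [-> _] _].
have cardX : #|X| = 2 + #|Y :&: [set z in s]|.
  by rewrite !cardsU1 !inE (negbTE xny) (negbTE xY) (negbTE yY).
have cyc1 : is_cycle e (x :: s ++ y :: rev m).
  rewrite /is_cycle /ucycleb cycle_glue p1 -rev_path_sym pm.
  apply/andP; split; last first.
    by move: szm; rewrite /= size_cat /= size_rev; goal_lia.
  have : uniq ((x :: s ++ [:: y]) ++ rev m).
    rewrite cat_uniq rev_uniq um andbT.
    have := uc; rewrite -(cat1s y) -(cat_cons x) catA cat_uniq.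
    rewrite cat_cons => /and3P [-> _ _]; rewrite andTb.
    apply/hasPn => z; rewrite mem_rev => /mc /andP [zc _]; apply: contra zc.
    by rewrite !(inE, mem_cat) => /or3P [] ->; rewrite ?orbT.
  by rewrite cat_cons -catA.
have sz1 : size (x :: s ++ y :: rev m) = size s + 2 + size m.
  by rewrite /= size_cat /= size_rev; goal_lia.
have dis1 z : z \in Q -> z \notin x :: s ++ y :: rev m.
  have notin1 : z \notin x :: s ++ [:: y] -> z \notin m -> z \notin x :: s ++ y :: rev m.
    by rewrite !(inE, mem_cat) mem_rev !negb_or => /and3P [-> -> ->] ->.
  rewrite inE => /orP [|zF].
    rewrite inE => zt; apply: notin1.
      have := uc; rewrite -(cat1s y) -(cat_cons x) catA cat_uniq cat_cons.
      by case/and3P => _ /hasPn /(_ z zt).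
    by apply/negP => /mc /andP [/negP []]; rewrite !(inE, mem_cat) in zt *; case/orP: zt => ->; rewrite !orbT.
  apply: notin1; last by apply/negP => /mc; rewrite zF andbF.
  have := dis z zF; apply: contra.
  by rewrite !(inE, mem_cat) => /or3P [] ->; rewrite ?orbT.
have sX1 : {subset X <= x :: s ++ y :: rev m}.
  move=> z; rewrite !inE mem_cat inE => /or3P [/eqP ->|/eqP ->|/andP [_ ->]];
    by rewrite ?eqxx ?orbT.
have tX1 z : z \in X -> touches Q z.
  case/setU1P => [->|/setU1P [->|]].
  - apply: tQ; apply/orP; left; apply/touchesP; exists (last b t).
      by rewrite inE mem_last.
    by move: p2; rewrite rcons_path e_sym => /andP [].
  - apply: tQ; apply/orP; left; apply/touchesP; exists b => //.
    by move: p2 => /= /andP [].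
  by rewrite inE => /andP [/tY tz _]; apply: tQ; rewrite tz orbT.
have := attachments_le_half x NB cyc1 cQ dis1 sX1 tX1.
rewrite cardX sz1 => le.
have sm : size m = 3 by move: szm le big; goal_lia.
case: m => [|m1 [|m2 [|m3 [|? ?]]]] // in sm pm um szm mc cyc1 sz1 dis1 sX1 le *.
have rE : rot (size s).+2 (x :: s ++ y :: rev [:: m1; m2; m3]) =
    [:: m3, m2, m1 & x :: s ++ [:: y]].
  have -> : (size s).+2 = size (x :: s ++ [:: y]) by rewrite /= size_cat addn1.
  have -> : x :: s ++ y :: rev [:: m1; m2; m3] =
      (x :: s ++ [:: y]) ++ [:: m3; m2; m1] by rewrite cat_cons -catA.
  by rewrite rot_size_cat.
have cyc2 : is_cycle e [:: m3, m2, m1 & x :: s ++ [:: y]] by rewrite -rE rot_is_cycle.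
have dis2 z : z \in Q -> z \notin [:: m3, m2, m1 & x :: s ++ [:: y]].
  by rewrite -rE mem_rot; exact: dis1.
have sX2 : {subset X <= [:: m3, m2, m1 & x :: s ++ [:: y]]}.
  by move=> z /sX1; rewrite -rE mem_rot.
have mX z : z \in [:: m1; m2; m3] -> z \notin X.
  move=> /mc /andP [zc _]; apply: contra zc; rewrite !inE mem_cat inE.
  by case/or3P => [/eqP ->|/eqP ->|/andP [_ ->]]; rewrite ?eqxx ?orbT.
have := attachments_alternate x NB cyc2 cQ dis2 sX2 tX1.
rewrite -rE size_rot sz1 cardX => /(_ _ m3 m2 _ rE).
rewrite (negbTE (mX m3 _)) ?(mX m2) ?inE ?eqxx ?orbT //.
suff -> : 2 * (2 + #|Y :&: [set z in s]|) = size s + 2 + size [:: m1; m2; m3].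
  by move/(_ erefl).
by move: le big; rewrite /=; goal_lia.
Qed.

Lemma no_short_detour c x y m : is_cycle e c -> (forall z, z \in F -> z \notin c) ->
  {subset Y <= c} -> 2 * #|Y| = size c -> x \in c -> x \notin Y ->
  y \in c -> y \notin Y -> x != y ->
  path e x (rcons m y) -> uniq m -> 0 < size m <= 3 ->
  (forall z, z \in m -> (z \notin c) && (z \notin F)) -> False.
Proof.
move=> cyc dis sY half xc xY yc yY xy pm um szm mc.
have [i s0 sE] := rot_to xc.
have memE z : (z \in rot i c) = (z \in c) by rewrite mem_rot.
have ys : y \in s0 by move: yc; rewrite -(mem_rot i) sE inE eq_sym (negbTE xy).
have cyc' : is_cycle e (rot i c) by rewrite rot_is_cycle.
have szE := size_rot i c.
case/splitPr: ys sE => s t sE; rewrite sE in memE cyc' szE.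
have rotE : rot (size (x :: s)) (x :: s ++ y :: t) = y :: t ++ x :: s.
  by rewrite -cat_cons rot_size_cat.
have cyc2 : is_cycle e (y :: t ++ x :: s) by rewrite -rotE rot_is_cycle.
have mem2 z : (z \in y :: t ++ x :: s) = (z \in c) by rewrite -rotE mem_rot memE.
have sz2 : size (y :: t ++ x :: s) = size c by rewrite -rotE size_rot.
have [big|small_s] := ltnP (size s) (2 * #|Y :&: [set z in s]|).
  apply: (@no_arc_detour x s y t m) => //; rewrite ?szE //.
  - by move=> z /dis; rewrite memE.
  - by move=> z /sY; rewrite memE.
  by move=> z /mc; rewrite memE.
apply: (@no_arc_detour y t x s (rev m)) => //; rewrite ?sz2 ?rev_uniq ?size_rev //.
- by move=> z /dis; rewrite mem2.
- by move=> z /sY; rewrite mem2.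
- by rewrite -rev_path_sym.
- by move=> z; rewrite mem_rev mem2 => /mc.
have : #|Y| <= #|Y :&: [set z in s]| + #|Y :&: [set z in t]|.
  apply: leq_trans (leq_card_setU _ _); apply: subset_leq_card.
  apply/subsetP => z zY; rewrite !inE zY /=.
  have := sY z zY; rewrite -memE inE mem_cat inE.
  case/or4P=> [/eqP zx|->|/eqP zy|->]; rewrite ?orbT //.
    by rewrite zx (negbTE xY) in zY.
  by rewrite zy (negbTE yY) in zY.
by move: small_s szE half; rewrite /= size_cat /=; goal_lia.
Qed.

End Detour.

(** ** The theorem of Bondy and Vince *)

Lemma sorted_tail L y M : sorted e (L ++ y :: M) -> path e y M.
Proof. by case: L => [|l L] //=; rewrite cat_path => /and3P []. Qed.

Lemma sorted_rev s : sorted e s -> sorted e (rev s).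
Proof. by rewrite rev_sorted; apply: sub_sorted => x y; rewrite e_sym. Qed.

Lemma sub_cycle3 A : has_cycle A -> 2 < #|A|.
Proof.
case=> c /andP [/andP [_ uc] sz] sub; apply: leq_trans sz _.
by rewrite cardE; apply: uniq_leq_size => // z /sub; rewrite mem_enum.
Qed.

Definition geodesic W a b p := [/\ path e a p, last a p = b, uniq (a :: p),
  {subset a :: p <= W} &
  forall q, path e a q -> last a q = b -> {subset a :: q <= W} -> size p <= size q].

Lemma exists_geodesic W a b : conn W -> a \in W -> b \in W -> exists p, geodesic W a b p.
Proof.
move=> cW aW bW; have [p0 [pth0 l0 _ s0]] := conn_uniq_path cW aW bW.
have [//|p [pth lp sp] min] :=
  @seq_argmin (fun p => [/\ path e a p, last a p = b & {subset a :: p <= W}]) p0.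
move: lp; case/shortenP: (pth) => p' pth' up' sub' lp'.
exists p'; split=> //.
  by move=> z; rewrite inE => /predU1P [-> //|/sub' zp]; apply: sp; rewrite inE zp orbT.
move=> q pq lq sq; apply: leq_trans (min q _); last by [].
by apply: uniq_leq_size => //; move: up' => /= /andP [].
Qed.

Lemma geodesic_shortcut W a b p x y (A B D M : seq T) : geodesic W a b p ->
  a :: p = A ++ x :: B ++ y :: D -> path e x (rcons M y) -> {subset M <= W} ->
  size B <= size M.
Proof.
case=> pth lp up sub min pE pM sM.
have [p' p'E] : exists p', A ++ x :: M ++ y :: D = a :: p'.
  by case: A pE => [|a' A] [-> _]; eexists.
have spE : sorted e (A ++ x :: B ++ y :: D) by rewrite -pE.
have sp' : sorted e (A ++ x :: M ++ y :: D).
  case: A spE {pE p'E} => [|a' A] /=.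
    rewrite -!cat_rcons !cat_path => /andP [_].
    by rewrite pM !last_rcons.
  rewrite !cat_path /= => /and3P [-> -> /=].
  by rewrite -!cat_rcons !cat_path pM !last_rcons => /andP [_].
have lE : last a p' = b.
  have -> : last a p' = last a (A ++ x :: M ++ y :: D) by rewrite p'E.
  have : last a (a :: p) = b by [].
  by rewrite pE !last_cat /= !last_cat.
have sE : {subset a :: p' <= W}.
  move=> z; rewrite -p'E => zp; have sub' : {subset A ++ x :: B ++ y :: D <= W}.
    by rewrite -pE.
  move: zp; rewrite !(mem_cat, inE) => /orP [zA|/or4P [zx|/sM //|zy|zD]];
    apply: sub'; rewrite !(mem_cat, inE) ?zA ?zx ?zy ?zD ?orbT //.
have pp' : path e a p' by move: sp'; rewrite p'E.
have := min p' pp' lE sE.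
have : (size p).+1 = size (A ++ x :: B ++ y :: D) by rewrite -pE.
have : (size p').+1 = size (A ++ x :: M ++ y :: D) by rewrite p'E.
rewrite !size_cat /= !size_cat /=; goal_lia.
Qed.

Lemma geodesic_dg W a b p x : geodesic W a b p -> x \in a :: p ->
  dg [set z in a :: p] x <= 2.
Proof.
move=> geo xp; case: (geo) => _ _ up _ _.
have [A [D pE]] : exists A D : seq T, a :: p = A ++ x :: D by case/splitPr: xp => A D; exists A, D.
apply: leq_trans (_ : #|[set last x A; head x D]| <= 2); last by rewrite cards2; case: eqP.
apply: subset_leq_card; apply/subsetP => z; rewrite inE [z \in _]inE pE mem_cat inE.
case/andP=> /or3P [zA|/eqP ->|zD] exz; last 2 first.
- by rewrite e_irr in exz.
- move: pE; case/splitPr: zD => B D' pE.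
  have := geodesic_shortcut (M := [::]) geo pE; rewrite /= exz => /(_ isT (fun _ => _)).
  move/(_ (fun _ h => match notF h with end)); case: B pE => // _ _.
  by rewrite !inE eqxx orbT.
move: pE; case/splitPr: zA => A' B; rewrite -catA cat_cons => pE.
have := geodesic_shortcut (M := [::]) geo pE; rewrite /= e_sym exz => /(_ isT).
move/(_ (fun _ h => match notF h with end)); case: B pE => // _ _.
by rewrite !inE last_cat eqxx.
Qed.

Lemma geodesic_no3 W a b p u x y z (A B B' D : seq T) : spread_out -> geodesic W a b p ->
  u \in W -> u \notin a :: p -> a :: p = A ++ x :: B ++ y :: B' ++ z :: D ->
  e u x -> e u y -> ~ e u z.
Proof.
move=> NB geo uW up pE ux uy uz.
have := @geodesic_shortcut W a b p x z A (B ++ y :: B') D [:: u] geo.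
rewrite -catA /= pE [e x u]e_sym ux uz => /(_ erefl isT).
have su : {subset [:: u] <= W} by move=> t; rewrite inE => /eqP ->.
move/(_ su); rewrite size_cat /=; case: B pE => [|? ?] pE; case: B' pE => [|? ?] pE /=; try goal_lia.
move=> _; case: geo => pth _ uap _ _.
have spE : sorted e (a :: p) by [].
rewrite pE /= in spE; have := sorted_tail spE => /= /and3P [exy eyz _].
have uE : uniq [:: u; x; y; z].
  rewrite cons_uniq; apply/andP; split.
    move: up; rewrite pE; apply: contra; rewrite mem_cat !inE.
    by case/or3P => ->; rewrite !orbT.
  move: uap; rewrite pE cat_uniq => /and3P [_ _].
  by rewrite -[x :: _]/([:: x; y; z] ++ D) cat_uniq => /andP [].
have c3 : is_cycle e [:: u; x; y].
  rewrite /is_cycle /ucycleb /= ux exy [e y u]e_sym uy /=.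
  by move: uE; rewrite /= !inE !negb_or -!andbA => /and5P [-> -> _ -> _].
have c4 : is_cycle e [:: u; x; y; z].
  by rewrite /is_cycle /ucycleb uE /= ux exy eyz [e z u]e_sym uz.
by have := NB _ _ c3 c4 isT.
Qed.

Lemma no_close_attachments x y z (B E : seq T) w q u : spread_out ->
  path e x (B ++ y :: E) -> uniq (x :: B ++ y :: E) -> last y E = z ->
  path e w q -> last w q = u -> uniq (w :: q) -> q != [::] ->
  (forall v, v \in w :: q -> v \notin x :: B ++ y :: E) ->
  e u x -> e u y -> e w z -> 1 < size B.
Proof.
move=> NB p1 u1 l1 p2 l2 u2 q0 dis ux uy wz.
have q1 : 0 < size q by case: (q) q0.
have cat_uniq_q s : uniq s -> {subset s <= x :: B ++ y :: E} -> uniq (s ++ w :: q).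
  move=> us sub; rewrite cat_uniq us u2 andbT; apply/hasPn => v tq.
  by apply: contra (dis v tq); exact: sub.
have c1 : is_cycle e (y :: E ++ w :: q).
  have uq : uniq (y :: E ++ w :: q).
    rewrite -cat_cons; apply: cat_uniq_q.
      by move: u1; rewrite -cat_cons cat_uniq => /and3P [].
    by move=> v; rewrite -(cat_cons x) mem_cat => ->; rewrite orbT.
  rewrite /is_cycle /ucycleb uq cycle_glue !rcons_path l1 l2 p2 uy [e z w]e_sym wz.
  rewrite (sorted_tail (L := x :: B) p1) /=.
  by rewrite size_cat /=; move: q1; goal_lia.
have c2 : is_cycle e (x :: (B ++ y :: E) ++ w :: q).
  have uq : uniq (x :: (B ++ y :: E) ++ w :: q).
    by rewrite -cat_cons; apply: cat_uniq_q.
  rewrite /is_cycle /ucycleb uq cycle_glue !rcons_path last_cat /= l1 l2 p2 ux.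
  rewrite [e z w]e_sym wz p1 /=.
  by rewrite size_cat /=; move: q1; goal_lia.
have := NB _ _ c1 c2; rewrite /= !size_cat /=; goal_lia.
Qed.

Lemma dg_closed A B v : A \subset B -> (forall z, z \in B :\: A -> ~~ e v z) ->
  dg B v = dg A v.
Proof.
move=> AB nz; rewrite (dg_setID _ AB); suff -> : dg (B :\: A) v = 0 by rewrite addn0.
by apply/eqP; rewrite -leqn0 leqNgt; apply/negP => /dg_gt0P [z /nz /negP].
Qed.

Lemma small_out Z F : F \subset Z ->
  small (Z :\: F) \subset rim Z F :|: (small Z :&: (Z :\: F)).
Proof.
move=> FZ; apply/subsetP => v; rewrite inE => /andP [vR dv].
rewrite in_setU in_setI vR andbT; have [//|vY] := boolP (v \in rim Z F).
by rewrite inE (not_rim_dg FZ vR vY) dv andbT; move: vR; rewrite inE => /andP [].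
Qed.

Lemma dg_rimU Z F v : F \subset Z -> v \in F -> dg Z v = dg (F :|: rim Z F) v.
Proof.
move=> FZ vF; apply: dg_closed.
  by rewrite subUset FZ (subset_trans (rim_sub Z F)) ?subsetDl.
move=> z; rewrite !inE negb_or => /andP [/andP [zF nz] zZ]; apply: contra nz => evz.
by rewrite zF zZ /=; apply/touchesP; exists v => //; rewrite e_sym.
Qed.

Lemma small_in Z F : F \subset Z ->
  small (F :|: rim Z F) \subset rim Z F :|: (small Z :&: F).
Proof.
move=> FZ; apply/subsetP => v; rewrite inE => /andP [vU dv].
rewrite in_setU in_setI; have [//|vY] := boolP (v \in rim Z F).
have vF : v \in F by move: vU; rewrite in_setU (negbTE vY) orbF.
by rewrite vF inE (subsetP FZ) // (dg_rimU FZ vF) dv.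
Qed.

Lemma first_neighbor u s : has (e u) s ->
  exists x (A D : seq T), [/\ s = A ++ x :: D, e u x & ~~ has (e u) A].
Proof.
by case/split_find => x A D ux nA; exists x, A, D; rewrite cat_rcons.
Qed.

Lemma card_le_size (A : {set T}) s : {subset A <= s} -> #|A| <= size s.
Proof.
by move=> sA; rewrite cardE; apply: uniq_leq_size; rewrite ?enum_uniq // => z; rewrite mem_enum => /sA.
Qed.

Lemma later_neighbors u s x (A D : seq T) : s = A ++ x :: D -> ~~ has (e u) A ->
  {subset [set z in [set z in s] | e u z] :\ x <= D}.
Proof.
move=> -> /hasPn nA z; rewrite !inE mem_cat inE => /and3P [/negbTE zx].
by rewrite zx /= => /orP [/nA /negbTE -> //|].
Qed.

Lemma geodesic_dg_out W a b p u : spread_out -> geodesic W a b p -> u \in W ->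
  u \notin a :: p -> dg [set z in a :: p] u <= 2.
Proof.
move=> NB geo uW up; rewrite leqNgt; apply/negP => d3.
have [|x [A [D [pE ux nA]]]] := @first_neighbor u (a :: p).
  have /dg_gt0P [z] : 0 < dg [set z in a :: p] u by apply: leq_trans d3.
  by rewrite inE => zp uz; apply/hasP; exists z.
have sub := later_neighbors pE nA.
set N := _ :\ x in sub; have : 1 < #|N|.
  by move: d3; rewrite /dg (cardsD1 x) -/N; case: (x \in _); goal_lia.
case/card_gt1P => y [z [yN zN yz]].
have yD := sub y yN; have zD := sub z zN.
have uy : e u y by move: yN; rewrite !inE => /and3P [].
have uz : e u z by move: zN; rewrite !inE => /and3P [].
case/splitPr: yD zD pE {sub} => D1 D2; rewrite mem_cat inE eq_sym (negbTE yz) /=.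
case/orP => /splitPr [E1 E2] pE; last exact: geodesic_no3 NB geo uW up pE ux uy uz.
by rewrite -catA cat_cons in pE; exact: geodesic_no3 NB geo uW up pE ux uz uy.
Qed.

(* Two leaves of the forest off a geodesic cannot be joined off the geodesic: shifting one end
   of the resulting cycle along the geodesic changes its length by one or two. *)
Lemma geodesic_no_leaves W a b p w q u : spread_out -> geodesic W a b p ->
  path e w q -> last w q = u -> uniq (w :: q) -> q != [::] -> {subset w :: q <= W} ->
  (forall v, v \in w :: q -> v \notin a :: p) ->
  1 < dg [set z in a :: p] u -> 1 < dg [set z in a :: p] w -> False.
Proof.
move=> NB geo pq lq uq q0 sq dis du dw.
have uw : u \in w :: q by rewrite -lq mem_last.
have [|x [A [D [pE ux nA]]]] := @first_neighbor u (a :: p).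
  have /dg_gt0P [z] : 0 < dg [set z in a :: p] u by apply: leq_trans du.
  by rewrite inE => zp uz; apply/hasP; exists z.
have sub := later_neighbors pE nA.
set N := _ :\ x in sub; have : 0 < #|N|.
  by move: du; rewrite /dg (cardsD1 x) -/N; case: (x \in _); goal_lia.
case/card_gt0P => y yN; have yD := sub y yN.
have uy : e u y by move: yN; rewrite !inE => /and3P [].
case/splitPr: yD pE {sub} => B D' pE.
have szB : size B <= 1.
  have := @geodesic_shortcut W a b p x y A B D' [:: u] geo pE.
  rewrite /= [e x u]e_sym ux uy; apply=> // v; rewrite inE => /eqP ->; exact: sq.
have [z zp] : exists2 z, z \in a :: p & e w z && (z \notin B).
  apply: NNPP => nz; have : dg [set z in a :: p] w <= size B.
    apply: card_le_size => z; rewrite !inE => /andP [zp wz].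
    by apply: contraT => zB; case: nz; exists z; rewrite ?inE ?wz.
  by move: dw szB; goal_lia.
case: geo => pp lp up _ _.
have sp : sorted e (a :: p) by [].
rewrite pE in sp up dis zp; case/andP=> wz zB.
have {}zp : (z \in rcons A x) || (z \in y :: D').
  by move: zp; rewrite mem_rcons !(inE, mem_cat) (negbTE zB) /=; case/or4P => ->; rewrite ?orbT.
have last_step E : path e x (B ++ y :: E) -> uniq (x :: B ++ y :: E) -> last y E = z ->
    {subset x :: B ++ y :: E <= A ++ x :: B ++ y :: D'} -> False.
  move=> pE' uE lE sE.
  have := no_close_attachments NB pE' uE lE pq lq uq q0 _ ux uy wz.
  rewrite ltnNge szB => /(_ _)/negP; apply=> // v vq; apply: contra (dis v vq); exact: sE.
have last_step' E : path e y (rev B ++ x :: E) -> uniq (y :: rev B ++ x :: E) ->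
    last x E = z -> {subset y :: rev B ++ x :: E <= A ++ x :: B ++ y :: D'} -> False.
  move=> pE' uE lE sE.
  have := no_close_attachments NB pE' uE lE pq lq uq q0 _ uy ux wz.
  rewrite size_rev ltnNge szB => /(_ _)/negP; apply=> // v vq; apply: contra (dis v vq); exact: sE.
case/orP: zp => [zA|zD].
  have revE : rev (A ++ x :: B ++ y :: D') = rev D' ++ y :: rev B ++ x :: rev A.
    by rewrite rev_cat rev_cons rev_cat rev_cons -!cats1 -!catA.
  have := sorted_rev sp; rewrite revE => /sorted_tail; rewrite -rev_uniq revE in up.
  have memr v : (v \in A ++ x :: B ++ y :: D') = (v \in rev D' ++ y :: rev B ++ x :: rev A).
    by rewrite -revE mem_rev.
  rewrite -mem_rev rev_rcons in zA.
  case/splitPl: zA up memr => E1 E2 lE up memr pE'.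
  apply: (last_step' E1) => //.
  - by move: pE'; rewrite -cat_cons catA cat_path => /andP [].
  - move: up; rewrite cat_uniq -(cat_cons x) catA -(cat_cons y) => /and3P [_ _].
    by rewrite cat_uniq => /andP [].
  move=> v; rewrite memr !(mem_cat, inE).
  by case/or4P => ->; rewrite ?orbT.
case/splitPl: zD sp up last_step {last_step' pE dis} => E1 E2 lE sp up last_step.
apply: (last_step E1) => //.
- by have := sorted_tail sp; rewrite -cat_cons catA cat_path => /andP [].
- move: up; rewrite cat_uniq -(cat_cons y) catA -(cat_cons x) => /and3P [_ _].
  by rewrite cat_uniq => /andP [].
move=> v; rewrite !(mem_cat, inE).
by case/or4P => ->; rewrite ?orbT.
Qed.

Lemma conn_or_separated W a : a \in W -> conn W \/
  exists A : {set T}, [/\ A \subset W, a \in A, A != W &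
    forall v z, v \in A -> z \in W :\: A -> ~~ e v z].
Proof.
move=> aW; pose r := [rel x y | [&& x \in W, y \in W & e x y]].
have rsym : connect_sym r.
  by apply: sym_connect_sym => x y; rewrite /= e_sym andbCA.
pose A := [set z in W | connect r a z].
have [AW|AW] := eqVneq A W.
  left=> u v uW vW; have cW z : z \in W -> connect r a z by rewrite -AW inE => /andP [].
  by apply: connect_trans (cW v vW); rewrite rsym cW.
right; exists A; split=> //; first by apply/subsetP => z; rewrite inE => /andP [].
  by rewrite inE aW connect0.
move=> v z; rewrite inE => /andP [vW av]; rewrite !inE => /andP [nz zW].
apply: contra nz => evz; rewrite zW; apply: connect_trans av _.
by apply: connect1; rewrite /= vW zW.
Qed.

Lemma has_cycle_off_small W F x : small W \subset F -> x \in W :\: F ->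
  (forall v, v \in W :\: F -> dg F v <= 1) -> F \subset W -> has_cycle (W :\: F).
Proof.
move=> sF xW dF FW; apply: cycle_of_min_dg.
  by apply/set0Pn; exists x.
move=> v vR; have := dF v vR; have : 2 < dg W v.
  rewrite ltnNge -ltnS; apply: contraL vR => dv; rewrite inE negb_and negbK.
  have [vW|] := boolP (v \in W); last by rewrite orbT.
  by rewrite (subsetP sF) // inE vW.
by rewrite (dg_setID _ FW); goal_lia.
Qed.

Section BondyVince.

Hypothesis NB : spread_out.

Lemma small_avoided_absurd W F0 :
  (forall R, #|R| < #|W| -> #|small R| <= 2 -> {in R, forall x, dg R x < 3}) ->
  F0 \subset W -> conn F0 -> F0 != set0 -> small W \subset F0 ->
  has_cycle (W :\: F0) -> False.
Proof.
move=> IH FW cF F0n sF hc; have [F F0F mF] := exists_maximal_avoiding FW cF hc.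
have [{}FW {}cF {}hc mx] := mF.
have S0 : small W :&: (W :\: F) = set0.
  apply/setP => v; rewrite !inE; apply/negP => /andP [/andP [vW dv] /andP [vF _]].
  by case/negP: vF; apply: (subsetP F0F); apply: (subsetP sF); rewrite inE vW.
have big v : v \in W :\: F -> 2 < dg W v.
  move=> vR; rewrite ltnNge -ltnS; apply/negP => dv.
  have := in_set0 v; rewrite -S0 in_setI vR inE dv andbT.
  by move: vR; rewrite inE => /andP [_ ->].
have [Y2|Y2] := ltnP 1 #|rim W F|.
  have [c sh] := exists_shortest hc.
  have := rim_le_small NB mF sh Y2; rewrite S0 cards0.
  have dp v : v \in W :\: F -> 0 < dg W v by move/big; goal_lia.
  by move/(_ dp); move: Y2; goal_lia.
have sR : #|small (W :\: F)| <= #|rim W F|.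
  by have := small_out FW; rewrite S0 setU0; exact: subset_leq_card.
have R3 := sub_cycle3 hc.
have lt : #|W :\: F| < #|W|.
  have /set0Pn [f fF] := F0n; have fF' := subsetP F0F f fF.
  rewrite (cardsD1 f W) (subsetP FW) // ltnS; apply: subset_leq_card.
  by apply/subsetP => z; rewrite !inE => /andP [zF ->]; rewrite andbT; apply: contraNneq zF => ->.
have all_small := IH _ lt (leq_trans (leq_trans sR Y2) (leqnSn 1)).
have : #|W :\: F| <= #|small (W :\: F)|.
  by apply: subset_leq_card; apply/subsetP => v vR; rewrite inE vR all_small.
by move: sR Y2 R3; goal_lia.
Qed.

Theorem two_small_all_small W : #|small W| <= 2 -> {in W, forall x, dg W x < 3}.
Proof.
have [n] := ubnP #|W|; elim: n W => // n IH W; rewrite ltnS => Wn sW x xW.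
rewrite ltnNge; apply/negP => dx.
have {}IH R : #|R| < #|W| -> #|small R| <= 2 -> {in R, forall x, dg R x < 3}.
  by move=> RW; apply: IH; apply: leq_trans RW Wn.
have avoid := @small_avoided_absurd W _ IH.
have W3 : 2 < #|W|.
  by apply: leq_trans dx _; apply: subset_leq_card; apply/subsetP => z; rewrite inE => /andP [].
have one a : a \in W -> small W \subset [set a] -> False.
  move=> aW sa; apply: (avoid [set a]) => //.
  - by rewrite sub1set.
  - exact: conn1.
  - by apply/set0Pn; exists a; rewrite inE.
  have /set0Pn [y yW] : W :\: [set a] != set0.
    by rewrite -card_gt0; move: W3; rewrite (cardsD1 a) aW; goal_lia.
  apply: (has_cycle_off_small sa yW); last by rewrite sub1set.
  move=> v _; rewrite -(cards1 a); apply: subset_leq_card.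
  by apply/subsetP => z; rewrite inE => /andP [].
have [s0|] := eqVneq (small W) set0; first by apply: (one x xW); rewrite s0 sub0set.
rewrite -card_gt0 => s1; have [/eqP/cards1P [a sE]|n1] := eqVneq #|small W| 1.
  have aW : a \in W by have := set11 a; rewrite -sE inE => /andP [].
  by apply: (one a aW); rewrite sE.
have /cards2P [a [b [ab sE]]] : #|small W| == 2 by move: sW s1 n1; goal_lia.
have aS : a \in small W by rewrite sE !inE eqxx.
have bS : b \in small W by rewrite sE !inE eqxx orbT.
have aW : a \in W by move: aS; rewrite inE => /andP [].
have bW : b \in W by move: bS; rewrite inE => /andP [].
have part A : A \subset W -> A != W -> (forall v z, v \in A -> z \in W :\: A -> ~~ e v z) ->
    x \notin A.
  move=> AW An cl; apply/negP => xA.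
  have dA v : v \in A -> dg W v = dg A v by move=> vA; apply: dg_closed => // z; exact: cl.
  have lt : #|A| < #|W| by apply: proper_card; rewrite properEneq An.
  have := IH A lt _ x xA; rewrite -dA // ltnNge dx => /(_ _)/notF; apply.
  apply: leq_trans sW; apply: subset_leq_card; apply/subsetP => v; rewrite !inE.
  by case/andP=> vA; rewrite (subsetP AW) //= dA.
have [cW|[A [AW aA An cl]]] := conn_or_separated aW; last first.
  have xA := part A AW An cl; suff : x \notin W :\: A by rewrite inE xA xW.
  apply: part; first exact: subsetDl.
    by apply: contraTneq aW => <-; rewrite inE aA.
  move=> v z vR; rewrite in_setD in_setD => /andP [zA zW].
  rewrite zW andbT negbK in zA.
  by rewrite e_sym; exact: cl.
have [p geo] := exists_geodesic cW aW bW; have [pp lp up sp _] := geo.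
pose F := [set z in a :: p].
have FW : F \subset W by apply/subsetP => z; rewrite inE => /sp.
have bF : b \in F by rewrite inE -lp mem_last.
have sF : small W \subset F.
  apply/subsetP => z; rewrite sE !inE => /orP [/eqP ->|/eqP zb]; first by rewrite eqxx.
  by move: bF; rewrite zb !inE.
have acyc : ~ has_cycle (W :\: F).
  apply: (avoid F) => //; first exact: conn_path.
  by apply/set0Pn; exists b.
have D0 : W :\: F != set0.
  have [xF|xF] := boolP (x \in F); last by apply/set0Pn; exists x; rewrite inE xF.
  have := geodesic_dg geo; rewrite -/F => /(_ x); rewrite inE in xF => /(_ xF).
  move: dx; rewrite (dg_setID _ FW) => dx dF.
  have /dg_gt0P [z zD _] : 0 < dg (W :\: F) x by move: dx dF; goal_lia.
  by apply/set0Pn; exists z.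
have outP v : v \in W :\: F -> [/\ v \in W, v \notin a :: p & 2 < dg F v + dg (W :\: F) v].
  rewrite !inE => /andP [vF vW]; split=> //.
  rewrite -(dg_setID _ FW) ltnNge -ltnS; apply: contra vF => dv.
  by have := subsetP sF v; rewrite !inE vW dv => ->.
have [v vD dv] := acyclic_leaf acyc D0.
have [vW vp dv3] := outP v vD.
have dF2 := geodesic_dg_out NB geo vW vp.
have /dg_gt0P [v1 v1D ev1] : 0 < dg (W :\: F) v by move: dv3 dF2; rewrite -/F; goal_lia.
have [|||w [q [pq uq sq lq /andP [szq dw]]]] := @extend_to_leaf (W :\: F) v1 [:: v] acyc.
- by rewrite /= e_sym ev1.
- by rewrite /= inE andbT; apply: contraTneq ev1 => ->; rewrite e_irr.
- by move=> z; rewrite !inE => /orP [/eqP ->|/eqP ->]; [move: v1D|move: vD]; rewrite !inE.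
have [wW wp dw3] := outP w (sq w (mem_head _ _)).
apply: (geodesic_no_leaves NB geo pq lq uq).
- by case: (q) szq.
- by move=> z /sq; rewrite inE => /andP [].
- by move=> z /sq /outP [].
- by move: dv3 dv; rewrite -/F /=; goal_lia.
by move: dw3 dw; rewrite -/F; goal_lia.
Qed.

End BondyVince.

(** ** Deleting ears *)

Lemma tight_no_detour Z F c v a v' : spread_out -> maximal_avoiding Z F ->
  shortest_in (Z :\: F) c -> 1 < #|rim Z F| ->
  (forall u, u \in Z :\: F -> 0 < dg Z u) ->
  #|rim Z F| = #|small Z :&: (Z :\: F)| ->
  v \in small Z :&: (Z :\: F) -> a \notin Z -> v' \in small Z -> v' != v ->
  e v a -> e a v' -> False.
Proof.
move=> NB mF sh Y2 dp tight vS aZ v'S v'v eva eav'.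
have half := tight_half NB mF sh Y2 dp tight.
have [r rinj rP] := tight_roots NB mF sh Y2 dp tight.
have sY := rim_on_cycle mF sh.
have [FZ cF _ _] := mF; have [cyc cR _] := sh.
have tY y : y \in rim Z F -> touches F y by rewrite inE => /andP [].
have Foff z : z \in F -> z \notin c.
  by move=> zF; apply/negP => /cR; rewrite inE zF.
have aF : a \notin F by apply: contra aZ; exact: (subsetP FZ).
have ac : a \notin c by apply/negP => /cR; rewrite inE (negbTE aZ) andbF.
have vR : v \in Z :\: F by move: vS; rewrite in_setI => /andP [].
have vF : v \notin F by move: vR; rewrite inE => /andP [].
have av : a != v by apply: contraNneq aZ => ->; move: vR; rewrite inE => /andP [].
have v'Z : v' \in Z by move: v'S; rewrite inE => /andP [].
have av' : a != v' by apply: contraNneq aZ => ->.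
have [rc rY rv] := rP v vS.
have [v'F|v'F] := boolP (v' \in F).
  have ta : touches F a by apply/touchesP; exists v'.
  case/orP: rv => /andP [vc].
    move/eqP=> rv; rewrite rv in rc rY.
    have := @no_outer_link F _ NB cF tY c v a [::] cyc Foff sY half rc rY.
    rewrite /= eva ta => /(_ isT) h; suff : false by [].
    by apply: h => z; rewrite inE => /eqP ->.
  move=> evr.
  have := @no_outer_link F _ NB cF tY c (r v) v [:: a] cyc Foff sY half rc rY.
  rewrite /= [e _ v]e_sym evr eva ta => /(_ isT) h; suff : false by [].
  by apply: h => z; rewrite !inE => /orP [] /eqP ->.
have v'R : v' \in Z :\: F by rewrite inE v'F.
have v'SR : v' \in small Z :&: (Z :\: F) by rewrite in_setI v'S.
have [rc' rY' rv'] := rP v' v'SR.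
have rr : r v != r v' by apply: contraNneq v'v => /(rinj _ _ vS v'SR) ->.
have detour m := @no_short_detour F _ NB cF tY c (r v) (r v') m cyc Foff sY half
  rc rY rc' rY' rr.
case/orP: rv => /andP [vc]; [move/eqP=> rv|move=> evr];
  (case/orP: rv' => /andP [vc']; [move/eqP=> rv'|move=> evr']).
- apply: (detour [:: a]) => //; first by rewrite /= rv rv' eva eav'.
  by move=> z; rewrite inE => /eqP ->; rewrite ac aF.
- apply: (detour [:: a; v']) => //; first by rewrite /= rv eva eav' evr'.
    by rewrite /= inE av'.
  by move=> z; rewrite !inE => /orP [] /eqP ->; rewrite ?ac ?aF ?vc' ?v'F.
- apply: (detour [:: v; a]) => //; first by rewrite /= rv' [e _ v]e_sym evr eva eav'.
    by rewrite /= inE eq_sym av.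
  by move=> z; rewrite !inE => /orP [] /eqP ->; rewrite ?ac ?aF ?vc ?vF.
apply: (detour [:: v; a; v']) => //.
- by rewrite /= [e _ v]e_sym evr eva eav' evr'.
- by rewrite /= !inE negb_or [v == a]eq_sym av [v == v']eq_sym v'v av'.
by move=> z; rewrite !inE => /or3P [] /eqP ->; rewrite ?ac ?aF ?vc ?vF ?vc' ?v'F.
Qed.

Lemma sum_dg_bound Z : 3 * #|Z| <= \sum_(v in Z) dg Z v + 3 * #|small Z|.
Proof.
have sZ : small Z \subset Z by apply/subsetP => v; rewrite inE => /andP [].
rewrite -(sum_indicator sZ) big_distrr mulnC -sum_nat_const -big_split /=.
apply: leq_sum => v vZ; rewrite inE vZ /=.
by case: (ltnP (dg Z v) 3) => d3; rewrite ?muln1 ?leq_addl // muln0 addn0.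
Qed.

Lemma acyclic_card Z : ~ has_cycle Z -> #|Z| <= 3 * #|small Z|.
Proof.
move=> acyc; have [->|Z0] := eqVneq Z set0; first by rewrite cards0.
by have := acyclic_sum_dg acyc Z0; have := sum_dg_bound Z; goal_lia.
Qed.

Lemma independent_off_shortest_card Z c : spread_out -> shortest_in Z c ->
  (forall x y, x \in Z -> y \in Z -> x \notin c -> y \notin c -> ~~ e x y) ->
  #|Z| <= 3 * #|small Z|.
Proof.
move=> NB sh indep; have [cyc cZ _] := sh.
pose C := [set x in c]; pose D := Z :\: C.
have CZ : C \subset Z by apply/subsetP => x; rewrite inE => /cZ.
have inD x : x \in D -> x \in Z /\ x \notin c by rewrite !inE => /andP [].
have DS : D \subset small Z.
  apply/subsetP => x /inD [xZ xc]; rewrite inE xZ (dg_closed CZ).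
    by rewrite ltnS; exact: shortest_dg_out NB sh xZ xc.
  by move=> z /inD [zZ zc]; exact: indep.
have dC x : x \in D -> dg C x <= 2 by case/inD => xZ xc; exact: shortest_dg_out NB sh xZ xc.
have big_le : #|C :\: small Z| <= \sum_(v in C :\: small Z) dg D v.
  rewrite -sum1_card; apply: leq_sum => v; rewrite in_setD => /andP [vS vC].
  have vc : v \in c by rewrite inE in vC.
  have := shortest_chordless sh vc; have : 2 < dg Z v.
    by move: vS; rewrite inE (subsetP CZ) //= -leqNgt.
  by rewrite (dg_setID _ CZ) -/C -/D; goal_lia.
have sum_le : \sum_(v in C :\: small Z) dg D v <= 2 * #|D|.
  apply: leq_trans (_ : \sum_(v in C) dg D v <= _).
    rewrite [leqRHS](bigID (mem (small Z))) /= addnC.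
    apply: leq_trans (leq_addr _ _); rewrite leq_eqVlt; apply/orP; left; apply/eqP.
    by apply: eq_bigl => v; rewrite inE andbC.
  have -> : \sum_(v in C) dg D v = \sum_(u in D) dg C u.
    rewrite (eq_bigr (fun v => \sum_(u in D) e v u)); last by move=> v _; rewrite dg_sum.
    rewrite exchange_big /=; apply: eq_bigr => u _; rewrite dg_sum.
    by apply: eq_bigr => v _; rewrite e_sym.
  by rewrite mulnC -sum_nat_const; apply: leq_sum => u; exact: dC.
have ZE : #|Z| = #|C| + #|D| by rewrite cardsD (setIidPr CZ) subnKC // subset_leq_card.
have CE := cardsID (small Z) C.
have SE : #|small Z| = #|C :&: small Z| + #|D|.
  rewrite -(cardsID C (small Z)) setIC; congr (_ + _); apply: eq_card => v.
  rewrite [v \in small Z :\: C]in_setD [v \in D]in_setD.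
  have [//|vC] := boolP (v \in C).
  rewrite !andTb; apply/idP/idP => [|vZ]; first by rewrite inE => /andP [].
  by apply: (subsetP DS); rewrite in_setD vC.
by move: big_le sum_le ZE CE SE; goal_lia.
Qed.

(* Without the constant 25, [order_bound_split] would fail at s = r = 2. *)
Definition order_bound k := if k < 3 then k else 5 * k ^ 2 - 25.

Lemma order_boundE m : order_bound m.+3 = 5 * (m * m) + 30 * m + 20.
Proof. by rewrite /order_bound /= !expnS expn0 muln1; clear; nia. Qed.

Lemma order_bound_mono : {homo order_bound : m n / m <= n}.
Proof.
move=> [|[|[|m]]] [|[|[|n]]] // mn; rewrite !order_boundE;
  try (by apply: leq_trans (leq_addl _ 20)).
rewrite !ltnS in mn; have := leq_mul mn mn; move: mn.
by move: (m * m) (n * n) => mm nn; goal_lia.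
Qed.

Lemma order_bound_pred k : 2 < k -> order_bound k.-1 + 4 * k <= order_bound k.
Proof. by case: k => [|[|[|[|k]]]] // _; rewrite !order_boundE; clear; nia. Qed.

Lemma order_bound_ge k : 2 < k -> 5 * k <= order_bound k.
Proof. by case: k => [|[|[|k]]] // _; rewrite order_boundE; clear; nia. Qed.

Lemma order_bound_split (s r : nat) : 1 < s -> 1 < r ->
  order_bound s.+1 + order_bound r.+1 + 2 * (s + r) <= order_bound (s + r).
Proof.
case: s => [|[|s]] // _; case: r => [|[|r]] // _.
have -> : s.+2 + r.+2 = (s + r).+1.+3 by goal_lia.
by rewrite !order_boundE; clear; nia.
Qed.

Section Induction.

Variable V : {set T}.
Hypothesis NB : spread_out.
Hypothesis IHV : forall W, #|W| < #|V| -> #|W| <= order_bound #|small W|.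

Let k := #|small V|.

Hypothesis k3 : 2 < k.

Let IHm W m : #|W| < #|V| -> #|small W| <= m -> #|W| <= order_bound m.
Proof. by move=> /IHV le sm; apply: leq_trans le _; exact: order_bound_mono. Qed.

(* A vertex of degree less than three in Z which was not so in V has lost a neighbour [a] to
   the deleted part, and [a] leads back to another such vertex. *)
Definition reduction_of Z := [/\ Z \subset V, #|small Z| <= k,
  forall v, v \in small Z -> v \notin small V -> exists a v',
    [/\ a \notin Z, v' \in small Z, v' \notin small V, v' != v & e v a && e a v'] &
  #|V| + 2 * #|small Z :&: small V| <= #|Z| + 2 * k].

Let splits Z F : F \subset Z -> 1 < #|F| -> Z \subset V -> #|small Z| = k ->
  has_cycle (Z :\: F) -> #|rim Z F| <= 1 -> #|Z| + 2 * k <= order_bound k.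
Proof.
move=> FZ F2 ZV Zk /sub_cycle3 R3 Y1.
set Y := rim Z F in Y1; set R := Z :\: F in R3.
have ZE : #|Z| = #|F| + #|R| by rewrite cardsD (setIidPr FZ) subnKC // subset_leq_card.
have ZVc := subset_leq_card ZV.
have kE : k = #|small Z :&: R| + #|small Z :&: F|.
  rewrite -Zk -(cardsID F) addnC; congr (_ + _); apply: eq_card => v.
  rewrite in_setI in_setD andbC [v \in R]in_setD.
  have [vS|//] := boolP (v \in small Z).
  by move: vS; rewrite inE => /andP [-> _]; rewrite andbT.
have FYE : #|F :|: Y| = #|F| + #|Y|.
  rewrite cardsU disjoint_setI0 ?cards0 ?subn0 // disjoint_sym disjoint_subset.
  by apply/subsetP => y /(subsetP (rim_sub Z F)); rewrite inE => /andP [].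
have YR : #|Y| <= #|R| by exact: subset_leq_card (rim_sub Z F).
have smR := leq_trans (subset_leq_card (small_out FZ)) (leq_card_setU _ _).
have smF := leq_trans (subset_leq_card (small_in FZ)) (leq_card_setU _ _).
rewrite -/Y -/R in smR smF.
have all_small W : #|small W| <= 2 -> #|W| <= #|small W|.
  move=> W2; apply: subset_leq_card; apply/subsetP => v vW.
  by rewrite inE vW (two_small_all_small NB W2).
have s2 : 1 < #|small Z :&: R|.
  rewrite ltnNge; apply/negP => s1.
  by have := all_small R; move: R3 smR Y1 s1; goal_lia.
have r2 : 1 < #|small Z :&: F|.
  rewrite ltnNge; apply/negP => r1.
  by have := all_small (F :|: Y); move: F2 smF Y1 r1 FYE; goal_lia.
have hR : #|R| <= order_bound (#|small Z :&: R|.+1).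
  by apply: IHm; [move: ZE ZVc F2|move: smR Y1]; goal_lia.
have hF : #|F :|: Y| <= order_bound (#|small Z :&: F|.+1).
  by apply: IHm; [move: ZE ZVc FYE Y1 R3|move: smF Y1]; goal_lia.
have := order_bound_split s2 r2; rewrite -kE; move: ZE FYE hR hF; goal_lia.
Qed.

Lemma reduction_bound Z : reduction_of Z -> #|V| <= order_bound k.
Proof.
have [n] := ubnP #|Z|; elim: n Z => // n IH Z; rewrite ltnS => Zn [ZV Zk used big].
have VZ : #|V| <= #|Z| + 2 * k by apply: leq_trans big; rewrite leq_addr.
have obp := order_bound_pred k3; have obg := order_bound_ge k3.
have ZVc := subset_leq_card ZV.
have smaller W : W \subset Z -> #|small W| < k -> #|W| <= order_bound k.-1.
  move=> WZ Wk; apply: IHm; last by move: Wk k3; goal_lia.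
  rewrite ltn_neqAle (leq_trans (subset_leq_card WZ) ZVc) andbT.
  apply: contraTneq Wk => WV; have -> : W = V.
    by apply/eqP; rewrite eqEcard (subset_trans WZ ZV) WV leqnn.
  by rewrite -leqNgt.
have [Zlt|Zge] := ltnP #|small Z| k.
  by have := smaller Z (subxx _) Zlt; move: VZ obp; goal_lia.
have {Zge}Zk : #|small Z| = k by apply/eqP; rewrite eqn_leq Zk.
have [/exists_inP [v vZ /eqP dv]|/exists_inPn dpos] := boolP [exists v in Z, dg Z v == 0].
  have nv w : w \in Z -> ~~ e w v.
    move=> wZ; apply/negP => ewv; have : 0 < dg Z v by apply/dg_gt0P; exists w; rewrite ?[e v w]e_sym.
    by rewrite dv.
  have vS : v \in small Z by rewrite inE vZ dv.
  have sub : small (Z :\ v) \subset small Z :\ v.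
    apply/subsetP => w; rewrite !inE => /andP [/andP [-> wZ] dw]; rewrite wZ /=.
    by rewrite (dgD1 _ vZ) (negbTE (nv w wZ)) addn0.
  have := smaller (Z :\ v) (subsetDl _ _).
  have := subset_leq_card sub; have := cardsD1 v Z; have := cardsD1 v (small Z).
  by rewrite vZ vS Zk; move: VZ obp k3; goal_lia.
have {}dpos v : v \in Z -> 0 < dg Z v by move=> /dpos; rewrite lt0n.
have [hc|acyc] := classic (has_cycle Z); last first.
  by have := acyclic_card acyc; rewrite Zk; move: VZ obg; goal_lia.
have [c0 sh0] := exists_shortest hc.
have [[x [y [xZ yZ xc yc exy]]]|indep] := classic (exists x y,
    [/\ x \in Z, y \in Z, x \notin c0, y \notin c0 & e x y]); last first.
  have := independent_off_shortest_card NB sh0; rewrite Zk => h.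
  suff : #|Z| <= 3 * k by move: VZ obg; goal_lia.
  apply: h => x y xZ yZ xc yc; apply/negP => exy; apply: indep.
  by exists x, y.
have cF0 : conn ([set x] :|: [set y]).
  by apply: connU (@conn1 x) (@conn1 y) _ _ exy; rewrite inE.
have F0Z : [set x] :|: [set y] \subset Z by rewrite subUset !sub1set xZ yZ.
have hc0 : has_cycle (Z :\: ([set x] :|: [set y])).
  case: sh0 => cyc0 sub0 _; exists c0 => // z zc; rewrite !inE sub0 // andbT.
  by apply/norP; split; [apply: contraNneq xc|apply: contraNneq yc] => <-.
have [F F0F mF] := exists_maximal_avoiding F0Z cF0 hc0.
have F2 : 1 < #|F|.
  apply: leq_trans (subset_leq_card F0F); rewrite cards2.
  by case: eqVneq exy => // ->; rewrite e_irr.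
have [FZ cF hcR mx] := mF.
have [Y2|Y1] := ltnP 1 #|rim Z F|; last first.
  exact: leq_trans VZ (splits FZ F2 ZV Zk hcR Y1).
have dposR v : v \in Z :\: F -> 0 < dg Z v by rewrite inE => /andP [_ /dpos].
have [c sh] := exists_shortest hcR.
have Ys := rim_le_small NB mF sh Y2 dposR.
have Bs := ear_le_small mF sh Y2 dposR.
set Y := rim Z F in Y2 Ys Bs *; set R := Z :\: F in hcR mx dposR sh Ys Bs *.
set S := small Z :&: R in Ys Bs; pose Z' := F :|: Y.
have YR : Y \subset R by exact: rim_sub.
have RZ : R \subset Z by exact: subsetDl.
have Z'Z : Z' \subset Z by rewrite subUset FZ (subset_trans YR).
have BE : Z :\: Z' = R :\: Y by rewrite setDDl.
have ZE : #|Z| = #|Z'| + #|R :\: Y|.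
  by rewrite -BE cardsD (setIidPr Z'Z) subnKC // subset_leq_card.
have kE : k = #|small Z :&: F| + #|S|.
  rewrite -Zk -(cardsID F); congr (_ + _); apply: eq_card => v.
  rewrite in_setI in_setD andbC [v \in R]in_setD.
  have [vS|//] := boolP (v \in small Z).
  by move: vS; rewrite inE => /andP [-> _]; rewrite andbT.
have smF := small_in FZ; rewrite -/Y -/Z' in smF.
have smF' := leq_trans (subset_leq_card smF) (leq_card_setU _ _).
have [lt|ge] := ltnP #|small Z'| k.
  by have := smaller Z' Z'Z lt; move: ZE Bs kE VZ obp; goal_lia.
have tight : #|Y| = #|S| by move: ge smF' kE Ys; goal_lia.
have smE : small Z' = Y :|: (small Z :&: F).
  apply/eqP; rewrite eqEcard smF (leq_trans (leq_card_setU _ _)) //.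
  by move: ge kE tight; goal_lia.
have usedF v : v \in small Z -> v \notin small V -> v \in F.
  move=> vS nv; have [a [v' [aZ v'S _ v'v /andP [eva eav']]]] := used v vS nv.
  apply: contraT => vF; have vSR : v \in S.
    by rewrite in_setI vS inE vF; move: vS; rewrite inE => /andP [].
  by case: (tight_no_detour NB mF sh Y2 dposR tight vSR aZ v'S v'v eva eav').
have YnS u : u \in Y -> u \notin small Z.
  by move=> /(rim_dg mF) d3; rewrite inE negb_and -leqNgt d3 orbT.
have dg_mono v : dg Z v <= dg V v by exact: dg_sub.
have YnV u : u \in Y -> u \notin small V.
  move=> /(rim_dg mF) d3; rewrite inE negb_and -leqNgt.
  by rewrite (leq_trans d3 (dg_mono u)) orbT.
have SV : S \subset small V.
  apply/subsetP => v; rewrite in_setI => /andP [vS vR]; apply: contraT => nv.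
  by have := usedF v vS nv; move: vR; rewrite inE => /andP [/negbTE ->].
have SB : #|S| <= #|R :\: Y|.
  apply: subset_leq_card; apply/subsetP => v; rewrite in_setI in_setD => /andP [vS ->].
  by rewrite andbT; apply: contraL vS; exact: YnS.
apply: (IH Z'); first by move: Zn ZE SB Y2 tight; goal_lia.
split.
- exact: subset_trans Z'Z ZV.
- by move: smF' kE tight; goal_lia.
- move=> v; rewrite smE in_setU => /orP [vY _|]; last first.
    rewrite in_setI => /andP [vS vF] nv.
    have [a [v' [aZ v'S nv' v'v ee]]] := used v vS nv; exists a, v'; split=> //.
      by apply: contra aZ; exact: (subsetP Z'Z).
    by rewrite in_setU in_setI v'S (usedF v' v'S nv') orbT.
  have cyc : is_cycle e c by case: sh.
  have cR : {subset c <= R} by case: sh.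
  have half := tight_half NB mF sh Y2 dposR tight.
  have Foff z : z \in F -> z \notin c by move=> zF; apply/negP => /cR; rewrite inE zF.
  have tY y0 : y0 \in Y -> touches F y0 by rewrite inE => /andP [].
  have [a [y' [ac aY y'Y y'v ee]]] :=
    attachments_two_steps NB cyc cF Foff (rim_on_cycle mF sh) tY half vY.
  exists a, y'; split=> //; last exact: YnV.
    rewrite in_setU negb_or aY andbT; apply/negP => /Foff; by rewrite ac.
  by rewrite in_setU y'Y.
have small_split : #|small Z' :&: small V| + #|S| <= #|small Z :&: small V|.
  rewrite -(cardsID F (small Z :&: small V)); apply: leq_add.
    apply: subset_leq_card; apply/subsetP => v; rewrite smE !in_setI in_setU.
    case/andP => /orP [/YnV /negbTE -> //|]; rewrite in_setI => /andP [-> ->] ->.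
    by [].
  apply: subset_leq_card; apply/subsetP => v vS; rewrite in_setD in_setI (subsetP SV) //.
  by move: vS; rewrite in_setI => /andP [-> ]; rewrite inE => /andP [->].
by move: small_split Bs ZE big; goal_lia.
Qed.

End Induction.

Theorem order_le_bound (V : {set T}) : spread_out -> #|V| <= order_bound #|small V|.
Proof.
move=> NB; have [n] := ubnP #|V|; elim: n V => // n IH V; rewrite ltnS => Vn.
have IHV W : #|W| < #|V| -> #|W| <= order_bound #|small W|.
  by move=> WV; apply: IH; apply: leq_trans WV Vn.
have [k3|k2] := ltnP 2 #|small V|.
  apply: (reduction_bound NB IHV k3 (Z := V)); split=> //; first by move=> v ->.
  by rewrite setIid.
rewrite /order_bound ltnS k2; apply: subset_leq_card; apply/subsetP => v vV.
by rewrite inE vV (two_small_all_small NB k2).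
Qed.
End Cycles.

Theorem mainTheorem1 (k : nat) (T : finType) (e : rel T)
    (simple_e : simple_graph e)
    (nonempty : 0 < #|T|)
    (few_small : #|[set v : T | degree e v < 3]| <= k)
    (large : 5 * k ^ 2 <= #|T|) :
  exists c1 c2 : seq T,
    [/\ is_cycle e c1, is_cycle e c2 &
        `|size c1 - size c2|%N \in [:: 1; 2]].
Proof.
apply: NNPP => no_pair; have [e_sym e_irr] := simple_e.
have NB : spread_out e.
  move=> c1 c2 cyc1 cyc2 lt; rewrite ltnNge; apply/negP => close.
  apply: no_pair; exists c1, c2; split=> //; rewrite !inE.
  by move: lt close; clear; lia.
have smallT : #|small e [set: T]| <= k.
  apply: leq_trans few_small; apply: subset_leq_card; apply/subsetP => v.
  rewrite !inE /degree; congr (_ < 3); apply: eq_card => w.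
  by rewrite !inE.
have := order_le_bound e_sym e_irr [set: T] NB; rewrite cardsT => le.
have {le} := leq_trans le (order_bound_mono smallT).
move: nonempty large; rewrite /order_bound; case: (ltnP k 3) => k3.
  by move: k3; rewrite !expnS expn0 muln1; clear; nia.
have : 0 < 5 * k ^ 2 by rewrite muln_gt0 expn_gt0; rewrite (leq_trans _ k3).
move: (5 * k ^ 2) => q; clear; lia.
Qed.
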